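(* Let $L_+>0$ be such that $\lambda_{\mathcal{T}_+}<1$, $\epsilon_0\sqrt{2n\nu_1^+d_{max}}<1$, $C_{M_1}<1$, $C_{M_2}<1$, and $$2\epsilon_0(C_Q+C_P)+\epsilon_0^2(C_Q^2+C_P^2)+\epsilon_b^2+2\epsilon_b(1+\epsilon_0C_P)+(1+\epsilon_0C_Q)^2\frac{C_{M_1}}{1-C_{M_1}}+(1+\epsilon_0C_P+\epsilon_b)^2\frac{C_{M_2}}{1-C_{M_2}}<1,$$ where all the constants (which depend on $L_+$) are as defined in the context. Then $\mathbb{E}^u_-(x)\cap\mathcal{D}=\{0\}$ for every $x\ge L_+$.
   Context: **Setting.** Let $n\ge2$, $D=\mathrm{diag}(d_1,\dots,d_n)$ with all $d_j>0$, $d_{min}=\min_jd_j$, $d_{max}=\max_jd_j$. Let $G\in C^2(\mathbb{R}^n,\mathbb{R})$ and let $\varphi$ be a nonconstant stationary solution, with limits $\varphi_\pm=\lim_{x\to\pm\infty}\varphi(x)$, of $v_t=Dv_{xx}+\nabla G(v)$. Put $\mathcal{M}(x)=\nabla^2G(\varphi(x))$. Assume: (H1) $\mathcal{M}\in C(\mathbb{R},\mathbb{R}^{n\times n})$ is real symmetric for each $x$. (H2) The limits $\mathcal{M}_\pm=\lim_{x\to\pm\infty}\mathcal{M}(x)$ exist, are negative definite, and have distinct eigenvalues. (H3) There are positive constants $C_M,\eta_M$ with $|\mathcal{M}(x)-\mathcal{M}_\pm|\le C_Me^{-\eta_M|x|}$ for $x\in\mathbb{R}^\pm$, respectively. (H4)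 $\lambda=0$ is an eigenvalue of geometric and algebraic multiplicity one of $\mathcal{L}u=Du_{xx}+\mathcal{M}(x)u$ on $L^2(\mathbb{R})$ with domain $H^2(\mathbb{R})$ (eigenfunction $\varphi'$). Consider the first-order system $$U_x=\tilde{\mathcal{A}}(x)U,\qquad \tilde{\mathcal{A}}(x)=\begin{pmatrix}0&D^{-1}\\-\mathcal{M}(x)&0\end{pmatrix},\qquad U\in\mathbb{R}^{2n}. \quad( * )$$ $\mathbb{E}^u_-(x)\subset\mathbb{R}^{2n}$ is the ($n$-dimensional) space of values at $x$ of solutions of $( * )$ that tend to $0$ as $x\to-\infty$; $\mathbb{E}^s_+(x)$ is the space of values at $x$ of solutions that tend to $0$ as $x\to+\infty$. $\mathcal{D}=\{(u,w)\in\mathbb{R}^{2n}:u=0\}$. By (H4), $\mathbb{E}^u_-(x)\cap\mathbb{E}^s_+(x)=\mathrm{span}\{U_\varphi(x)\}$ with $U_\varphi=(\varphi',D\varphi'')$. Fix solutions $U_1,\dots,U_{n-1}$ of $( * )$ with $\mathbb{E}^u_-(x)=\mathrm{span}\{U_\varphi(x),U_1(x),\dots,U_{n-1}(x)\}$. **Asymptotic basis at $+\infty$.** Let $\mathcal{A}_{+\infty}=\begin{pmatrix}0&D^{-1}\\-\mathcal{M}_+&0\end{pmatrix}$. Let $\{z_j^+\}_{j=1}^n$ be an orthonormal basis of $\mathbb{R}^n$ of eigenvectors of $D^{-1/2}\mathcal{M}_+D^{-1/2}$ with eigenvalues $-(\nu_j^+)^2$, ordered so that $\nu_1^+>\nu_2^+>\dots>\nu_n^+>0$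 (distinctness is assumed). The eigenvalues of $\mathcal{A}_{+\infty}$ are $\mp\nu_j^+$ with normalized eigenvectors $$V_j^{+,s}=\frac1{\sqrt{2\nu_j^+}}\begin{pmatrix}D^{-1/2}z_j^+\\-\nu_j^+D^{1/2}z_j^+\end{pmatrix},\qquad V_j^{+,u}=\frac1{\sqrt{2\nu_j^+}}\begin{pmatrix}D^{-1/2}z_j^+\\\nu_j^+D^{1/2}z_j^+\end{pmatrix}.$$ Let $K_+,\eta_+>0$ be constants such that for every eigenvalue $\nu$ of $\mathcal{A}_{+\infty}$, with $P^{s}$ (resp. $P^{cu}$) the spectral projection of $\mathcal{A}_{+\infty}-\nu$ onto eigenvalues with negative (resp. nonnegative) real part, $$\|e^{(\mathcal{A}_{+\infty}-\nu)(x-y)}P^{cu}\|\le K_+\ (0\le x\le y),\qquad \|e^{(\mathcal{A}_{+\infty}-\nu)(x-y)}P^{s}\|\le K_+e^{-\eta_+(x-y)}\ (0\le y\le x).$$ Define $$\lambda_{\mathcal{T}_+}=\frac{K_+C_M}{\eta_M}e^{-\eta_ML_+},\qquad \epsilon_0=\frac{\lambda_{\mathcal{T}_+}}{1-\lambda_{\mathcal{T}_+}}\max_{1\le j\le n}\max\{|V_j^{+,s}|,|V_j^{+,u}|\}.$$ When $\lambda_{\mathcal{T}_+}<1$ there exist solutions of $( * )$ of the form $$\tilde V_j^{+,s}(x)=e^{-\nu_j^+x}\big(V_j^{+,s}+\tilde W_j^{+,s}(x)\big),\qquad \tilde V_j^{+,u}(x)=e^{\nu_j^+x}\big(V_j^{+,u}+\tilde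 W_j^{+,u}(x)\big),$$ with $\tilde W_j^{+,s/u}(x)\to0$ as $x\to+\infty$ and $|\tilde W_j^{+,s/u}(x)|\le\frac{\lambda_{\mathcal{T}_+}}{1-\lambda_{\mathcal{T}_+}}|V_j^{+,s/u}|\le\epsilon_0$ for all $x\ge L_+$; fix such solutions. They form a basis of the solution space, and $\{\tilde V^{+,s}_j(x)\}_j$ is a basis of $\mathbb{E}^s_+(x)$. Define constants $\tilde\gamma_j^k,\tilde\beta_j^k\in\mathbb{R}$ by $$U_k(x)=\sum_{j=1}^n\big[\tilde\gamma^k_j\tilde V_j^{+,u}(x)+\tilde\beta_j^k\tilde V_j^{+,s}(x)\big],\qquad k=1,\dots,n-1,$$ and the $n\times(n-1)$ matrices $\tilde\Gamma=[\tilde\gamma^1|\cdots|\tilde\gamma^{n-1}]$, $\tilde B=[\tilde\beta^1|\cdots|\tilde\beta^{n-1}]$. **Constants.** Let $\mu^*=\min\{\mu:\mu\in\sigma(\tilde\Gamma^T\tilde\Gamma)\}$ and $$\epsilon_b=\frac1{\sqrt{\mu^*}}e^{-2\nu_n^+L_+}\|\tilde B\|,\qquad C_P=\frac{2\sqrt{2n\nu_1^+d_{max}}}{1-\epsilon_0\sqrt{2n\nu_1^+d_{max}}},\qquad C_Q=\sqrt{\frac{2n}{\nu_n^+d_{min}}}+\sqrt{2n\nu_1^+d_{max}}+2\epsilon_0n,$$ $$C_{M_1}=\epsilon_0C_Q(2+\epsilon_0C_Q),\qquad C_{M_2}=\epsilon_0C_P(2+\epsilon_0C_P)+2\epsilon_b(1+\epsilon_0C_P)+\epsilon_b^2.$$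 Norms are Euclidean vector norms and the induced operator norms. *)

(* Defs.v *)
From HB Require Import structures.
From mathcomp Require Import all_boot all_order all_algebra.
From mathcomp Require Import all_classical all_reals all_analysis.
From mathcomp Require Import complex.

Set Implicit Arguments.
Unset Strict Implicit.
Unset Printing Implicit Defensive.

Import Order.TTheory GRing.Theory Num.Theory.
Import numFieldNormedType.Exports.

Local Open Scope classical_set_scope.
Local Open Scope ring_scope.

(* The library norm on matrices is the entrywise maximum, hence the Euclidean
   and operator norms here.  Limits and derivatives of matrix-valued functions
   use the library topology, which is that of any norm. *)
Definition enorm (R : realType) (m : nat) (v : 'cV[R]_m) : R :=
  Num.sqrt (\sum_i v i 0 ^+ 2).

Definition opnorm (R : realType) (m p : nat) (A : 'M[R]_(m, p)) : R :=
  sup [set enorm (A *m v) | v in [set v : 'cV[R]_p | enorm v <= 1]].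

Definition expmx (R : realType) (m : nat) (A : 'M[R]_m) : 'M[R]_m :=
  lim (series (fun k : nat => (k`!%:R)^-1 *: A ^+ k) @ \oo).

(* P is the projection onto the sum of the (complex) generalized eigenspaces of
   the eigenvalues in S, along the sum of the other ones.  As the generalized
   eigenspaces span the whole space, this determines P. *)
Definition is_spectral_projection (R : realType) (m : nat) (A : 'M[R]_m)
    (S : pred R[i]) (P : 'M[R]_m) : Prop :=
  forall (lam : R[i]) (k : nat) (v : 'cV[R[i]]_m),
    (map_mx (real_complex R) A - lam%:M) ^+ k *m v = 0 ->
    map_mx (real_complex R) P *m v = if S lam then v else 0.

Definition neg_definite (R : realType) (m : nat) (A : 'M[R]_m) : Prop :=
  forall v : 'cV[R]_m, v != 0 -> (v^T *m A *m v) 0 0 < 0.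

Definition distinct_eigenvalues (R : realType) (m : nat) (A : 'M[R]_m) : Prop :=
  exists2 s : seq R, uniq s & char_poly A = \prod_(a <- s) ('X - a%:P).

Definition pd1 (R : realType) (n : nat) (G : 'cV[R]_n -> R) (i : 'I_n)
    (v : 'cV[R]_n) : R := 'D_(delta_mx i 0) G v.

Definition pd2 (R : realType) (n : nat) (G : 'cV[R]_n -> R) (i j : 'I_n)
    (v : 'cV[R]_n) : R := 'D_(delta_mx j 0) (pd1 G i) v.

Definition C2 (R : realType) (n : nat) (G : 'cV[R]_n -> R) : Prop :=
  [/\ continuous G,
      forall i v, derivable G v (delta_mx i 0),
      forall i, continuous (pd1 G i),
      forall i j v, derivable (pd1 G i) v (delta_mx j 0)
    & forall i j, continuous (pd2 G i j)].

Definition gradient (R : realType) (n : nat) (G : 'cV[R]_n -> R)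
    (v : 'cV[R]_n) : 'cV[R]_n := \col_i pd1 G i v.

Definition hessian (R : realType) (n : nat) (G : 'cV[R]_n -> R)
    (v : 'cV[R]_n) : 'M[R]_n := \matrix_(i, j) pd2 G i j v.

Definition stationary_solution (R : realType) (n : nat) (d : 'rV[R]_n)
    (G : 'cV[R]_n -> R) (phi : R -> 'cV[R]_n) : Prop :=
  forall x : R, [/\ derivable phi x 1, derivable (derive1 phi) x 1
    & diag_mx d *m derive1 (derive1 phi) x + gradient G (phi x) = 0].

(* Elements of L^2 and H^2 are represented by functions, identified when equal
   almost everywhere; derivatives in H^2 are weak derivatives. *)
Definition test_function (R : realType) (psi : R -> R) : Prop :=
  (forall (k : nat) (x : R), derivable (derive1n k psi) x 1) /\
  (exists a : R, forall x, a < `|x| -> psi x = 0).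

Definition weak_derivative (R : realType) (f g : R -> R) : Prop :=
  forall psi : R -> R, test_function psi ->
    \int[lebesgue_measure]_x (f x * derive1 psi x) =
    - \int[lebesgue_measure]_x (g x * psi x).

Definition eq_ae (R : realType) (n : nat) (u v : R -> 'cV[R]_n) : Prop :=
  {ae (@lebesgue_measure R), forall x, u x = v x}.

Definition L2 (R : realType) (n : nat) (u : R -> 'cV[R]_n) : Prop :=
  forall i, (fun x => u x i 0) \in Lfun (@lebesgue_measure R) 2%:E.

Definition weak_derivative_cV (R : realType) (n : nat)
    (u v : R -> 'cV[R]_n) : Prop :=
  forall i, weak_derivative (fun x => u x i 0) (fun x => v x i 0).

(* Graph of L u = D u_xx + M u on L^2 with domain H^2. *)
Definition Lgraph (R : realType) (n : nat) (d : 'rV[R]_n) (M : R -> 'M[R]_n)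
    (u f : R -> 'cV[R]_n) : Prop :=
  L2 f /\ exists u1 u2 : R -> 'cV[R]_n,
    [/\ L2 u /\ L2 u1 /\ L2 u2,
        weak_derivative_cV u u1, weak_derivative_cV u1 u2
      & eq_ae f (fun x => diag_mx d *m u2 x + M x *m u x)].

Definition Leigenspace (R : realType) (n : nat) (d : 'rV[R]_n)
    (M : R -> 'M[R]_n) (lam : R) : set (R -> 'cV[R]_n) :=
  [set u | Lgraph d M u (fun x => lam *: u x)].

(* Kernel of (L - lam)^k; the union over k is the generalized eigenspace. *)
Fixpoint Lkernel (R : realType) (n : nat) (d : 'rV[R]_n) (M : R -> 'M[R]_n)
    (lam : R) (k : nat) : set (R -> 'cV[R]_n) :=
  match k with
  | 0 => [set u | L2 u /\ eq_ae u (fun=> 0)]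
  | k'.+1 => [set u | exists2 f : R -> 'cV[R]_n,
               Lgraph d M u (fun x => f x + lam *: u x) & Lkernel d M lam k' f]
  end.

Definition one_dimensional_ae (R : realType) (n : nat)
    (E : set (R -> 'cV[R]_n)) : Prop :=
  exists u0, [/\ E u0, ~ eq_ae u0 (fun=> 0)
    & forall u, E u -> exists c : R, eq_ae u (fun x => c *: u0 x)].

Definition Lsimple_eigenvalue (R : realType) (n : nat) (d : 'rV[R]_n)
    (M : R -> 'M[R]_n) (lam : R) : Prop :=
  one_dimensional_ae (Leigenspace d M lam) /\
  one_dimensional_ae (\bigcup_k Lkernel d M lam k).

Definition Leigenfunction (R : realType) (n : nat) (d : 'rV[R]_n)
    (M : R -> 'M[R]_n) (lam : R) (u : R -> 'cV[R]_n) : Prop :=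
  Leigenspace d M lam u /\ ~ eq_ae u (fun=> 0).

Definition sysmx (R : realType) (n : nat) (d : 'rV[R]_n) (Mx : 'M[R]_n) :
    'M[R]_(n + n) :=
  block_mx 0 (invmx (diag_mx d)) (- Mx) 0.

Definition is_solution (R : realType) (n : nat) (d : 'rV[R]_n)
    (M : R -> 'M[R]_n) (U : R -> 'cV[R]_(n + n)) : Prop :=
  forall x : R, is_derive x (1 : R) U (sysmx d (M x) *m U x).

(* Values at x of the solutions tending to 0 at -oo. *)
Definition Eu_minus (R : realType) (n : nat) (d : 'rV[R]_n)
    (M : R -> 'M[R]_n) (x : R) : set 'cV[R]_(n + n) :=
  [set U x | U in [set U : R -> 'cV[R]_(n + n) | is_solution d M U /\ U t @[t --> -oo] --> (0 : 'cV[R]_(n + n))]].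

Definition Dirichlet (R : realType) (n : nat) : set 'cV[R]_(n + n) :=
  [set v | usubmx v = 0].

Definition Uphi (R : realType) (n : nat) (d : 'rV[R]_n)
    (phi : R -> 'cV[R]_n) (x : R) : 'cV[R]_(n + n) :=
  col_mx (derive1 phi x) (diag_mx d *m derive1 (derive1 phi) x).

Definition sqrtD (R : realType) (n : nat) (d : 'rV[R]_n) : 'M[R]_n :=
  diag_mx (map_mx Num.sqrt d).

Definition Vs (R : realType) (n : nat) (d : 'rV[R]_n) (nu : R)
    (z : 'cV[R]_n) : 'cV[R]_(n + n) :=
  (Num.sqrt (2 * nu))^-1 *:
    col_mx (invmx (sqrtD d) *m z) (- nu *: (sqrtD d *m z)).

Definition Vu (R : realType) (n : nat) (d : 'rV[R]_n) (nu : R)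
    (z : 'cV[R]_n) : 'cV[R]_(n + n) :=
  (Num.sqrt (2 * nu))^-1 *:
    col_mx (invmx (sqrtD d) *m z) (nu *: (sqrtD d *m z)).

Definition ord_first (n : nat) (hn : (1 < n)%N) : 'I_n := Ordinal (ltnW hn).

Lemma ord_last_proof (n : nat) (hn : (1 < n)%N) : (n.-1 < n)%N.
Proof. by rewrite ltn_predL (ltnW hn). Qed.

Definition ord_last (n : nat) (hn : (1 < n)%N) : 'I_n :=
  Ordinal (ord_last_proof hn).

(* Maximum and minimum of positive entries; junk values for n = 0. *)
Definition row_max (R : realType) (n : nat) (d : 'rV[R]_n) : R :=
  \big[Num.max/0]_(j < n) d 0 j.

Definition row_min (R : realType) (n : nat) (d : 'rV[R]_n) : R :=
  \big[Num.min/row_max d]_(j < n) d 0 j.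

(* For symmetric A with m > 0: a nonempty finite set of eigenvalues, all real,
   so that inf is min. *)
Definition min_spectrum (R : realType) (m : nat) (A : 'M[R]_m) : R :=
  inf [set a : R | eigenvalue A a].

(* Main.v *)
(* With omega the symplectic form, omega(U, V) is constant in x for any two
   solutions, as M is symmetric; hence E^u_- is isotropic, and Uphi, which is
   bounded at +oo, is a combination of the Vts_j alone.  At x >= L_p write an
   element of E^u_- with vanishing first component as
     v = sum_j p_j (Vu_j + Wu_j) + sum_j (s_j + b_j) (Vs_j + Ws_j),
   where b comes from Uphi and p, s from the columns of Gam, B.  The pairing
   omega(Vs_i, Vu_j) = delta_ij and isotropy give |b.p| <= eps0 C_Q |b| |p|,
   the Dirichlet condition gives |p + s + b| <= eps0 C_P |p|, and
   |s| <= eps_b |p|; thus p is almost orthogonal to b and close to -b, which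
   forces p = 0.  The bound on s needs mu_star > 0 (for mu_star = 0 the inverse
   in eps_b is the junk value 0), i.e. Gam injective: a kernel vector yields a
   solution decaying at both ends, a multiple of Uphi by (H4), so that E^u_-
   would have dimension less than n.
   The flux u.w of a solution (u, w) is nondecreasing near -oo; a compactness
   argument on the solutions with u(T) = 0, T -> -oo, gives n independent
   directions of nonnegative flux, and such solutions decay at -oo. *)

Require Import Defs.
From HB Require Import structures.
From mathcomp Require Import all_boot all_order all_algebra.
From mathcomp Require Import all_classical all_reals all_analysis.
From mathcomp Require Import complex.
From mathcomp Require Import measurable_realfun.
From mathcomp Require Import ring lra.

Set Implicit Arguments.
Unset Strict Implicit.
Unset Printing Implicit Defensive.

Import Order.TTheory GRing.Theory Num.Theory.
Import numFieldNormedType.Exports.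

Local Open Scope classical_set_scope.
Local Open Scope ring_scope.

(** * Euclidean and operator norms *)

Section dot.
Variable R : realType.
Implicit Types m n p : nat.

(** The span hypothesis bounds the dimension of E^u_- only from above, so the lower bound n has to
    be proved. It enters contrapositively: if the coefficient vectors of the spanning solutions had
    rank below n, a solution of nonnegative flux could be chosen with coefficients orthogonal to all
    of them, although its decay at -oo puts it in their span. Coefficients always refer to the 2n
    given solutions at +oo. That these form a basis is itself read off the symplectic pairing, which
    differs from the identity pairing by at most r = eps0 C_Q < 1; Gronwall uniqueness then
    describes every solution. (H4) speaks of L^2 functions up to null sets and of weak derivatives.
    A solution decaying at both ends therefore needs an exponential bound on the whole line, and the
    proportionality to phi' is brought back to every x by continuity. The factors e^(nu_j x) and
    e^(-nu_j x) are absorbed into p, s and b, which makes the estimates uniform in x >= L_p. The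
    smallness condition enters through (eps0 C_Q)^2 + (eps0 C_P + eps_b)^2 < 1, under which almost
    orthogonal and almost opposite vectors cannot coexist. *)

Definition dot m (u v : 'cV[R]_m) : R := (u^T *m v) 0 0.

Lemma dotE m (u v : 'cV[R]_m) : dot u v = \sum_i u i 0 * v i 0.
Proof. by rewrite /dot mxE; apply: eq_bigr => i _; rewrite mxE. Qed.

Lemma dotC m (u v : 'cV[R]_m) : dot u v = dot v u.
Proof. by rewrite !dotE; apply: eq_bigr => i _; rewrite mulrC. Qed.

Lemma dotDl m (u v w : 'cV[R]_m) : dot (u + v) w = dot u w + dot v w.
Proof. by rewrite /dot linearD mulmxDl mxE. Qed.

Lemma dotDr m (u v w : 'cV[R]_m) : dot w (u + v) = dot w u + dot w v.
Proof. by rewrite /dot mulmxDr mxE. Qed.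

Lemma dotNl m (u v : 'cV[R]_m) : dot (- u) v = - dot u v.
Proof. by rewrite /dot linearN mulNmx mxE. Qed.

Lemma dotNr m (u v : 'cV[R]_m) : dot u (- v) = - dot u v.
Proof. by rewrite /dot mulmxN mxE. Qed.

Lemma dotZl m a (u v : 'cV[R]_m) : dot (a *: u) v = a * dot u v.
Proof. by rewrite /dot linearZ -scalemxAl mxE. Qed.

Lemma dotZr m a (u v : 'cV[R]_m) : dot u (a *: v) = a * dot u v.
Proof. by rewrite /dot -scalemxAr mxE. Qed.

Lemma dot0l m (u : 'cV[R]_m) : dot 0 u = 0.
Proof. by rewrite /dot linear0 mul0mx mxE. Qed.

Lemma dot0r m (u : 'cV[R]_m) : dot u 0 = 0.
Proof. by rewrite /dot mulmx0 mxE. Qed.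

Lemma dot_sumr m n (u : 'cV[R]_m) (v : 'I_n -> 'cV[R]_m) :
  dot u (\sum_j v j) = \sum_j dot u (v j).
Proof.
by apply: (big_morph (dot u)) => [x y|]; rewrite ?dotDr ?dot0r.
Qed.

Lemma dot_mulmxl m p (A : 'M[R]_(m, p)) u v :
  dot (A *m u) v = dot u (A^T *m v).
Proof. by rewrite /dot trmx_mul mulmxA. Qed.

Lemma dot_delta m (u : 'cV[R]_m) i : dot (delta_mx i 0) u = u i 0.
Proof.
rewrite dotE (bigD1 i)//= big1 ?addr0; first by rewrite mxE !eqxx mul1r.
by move=> j ji; rewrite mxE (negbTE ji) mul0r.
Qed.

Lemma dot_col_mx m (u v w t : 'cV[R]_m) :
  dot (col_mx u v) (col_mx w t) = dot u w + dot v t.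
Proof. by rewrite /dot tr_col_mx mul_row_col mxE. Qed.

Lemma dot_ge0 m (u : 'cV[R]_m) : 0 <= dot u u.
Proof. by rewrite dotE sumr_ge0// => i _; rewrite -expr2 sqr_ge0. Qed.

Lemma dot_eq0 m (u : 'cV[R]_m) : dot u u = 0 -> u = 0.
Proof.
rewrite dotE => /eqP; rewrite psumr_eq0; last first.
  by move=> i _; rewrite -expr2 sqr_ge0.
move=> /allP u0; apply/matrixP => i j; rewrite ord1 mxE.
by have := u0 i (mem_index_enum i); rewrite /= -expr2 sqrf_eq0 => /eqP.
Qed.

Lemma dot_gt0 m (u : 'cV[R]_m) : u != 0 -> 0 < dot u u.
Proof.
move=> u0; rewrite lt_neqAle dot_ge0 andbT eq_sym.
by apply: contra_neq u0; exact: dot_eq0.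
Qed.

Lemma enorm_dot m (u : 'cV[R]_m) : enorm u = Num.sqrt (dot u u).
Proof. by rewrite /enorm dotE; congr Num.sqrt; apply: eq_bigr. Qed.

Lemma enorm_ge0 m (u : 'cV[R]_m) : 0 <= enorm u.
Proof. exact: sqrtr_ge0. Qed.

Lemma enorm_sqr m (u : 'cV[R]_m) : enorm u ^+ 2 = dot u u.
Proof. by rewrite enorm_dot sqr_sqrtr// dot_ge0. Qed.

Lemma enorm0 m : enorm (0 : 'cV[R]_m) = 0.
Proof. by rewrite enorm_dot dot0l sqrtr0. Qed.

Lemma enorm_eq0 m (u : 'cV[R]_m) : enorm u = 0 -> u = 0.
Proof. by move=> u0; apply: dot_eq0; rewrite -enorm_sqr u0 expr0n. Qed.

Lemma enormZ m a (u : 'cV[R]_m) : enorm (a *: u) = `|a| * enorm u.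
Proof.
by rewrite !enorm_dot dotZl dotZr mulrA -expr2 sqrtrM ?sqr_ge0// sqrtr_sqr.
Qed.

Lemma enormN m (u : 'cV[R]_m) : enorm (- u) = enorm u.
Proof. by rewrite -scaleN1r enormZ normrN1 mul1r. Qed.

Lemma enorm_le m (u : 'cV[R]_m) c : 0 <= c -> dot u u <= c ^+ 2 -> enorm u <= c.
Proof.
by move=> c0 uc; rewrite -(@ler_pXn2r _ 2) ?nnegrE ?enorm_ge0// enorm_sqr.
Qed.

Lemma dot_cauchy m (u v : 'cV[R]_m) : `|dot u v| <= enorm u * enorm v.
Proof.
rewrite -(@ler_pXn2r _ 2) ?nnegrE ?mulr_ge0 ?enorm_ge0//.
rewrite exprMn !enorm_sqr real_normK ?num_real//.
have [->|v0] := eqVneq v 0; first by rewrite !dot0r expr0n mulr0.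
have := dot_ge0 (dot v v *: u - dot u v *: v).
rewrite !(dotDl, dotDr, dotNl, dotNr, dotZl, dotZr) (dotC v u).
move: (dot u u) (dot u v) (dot v v) (dot_gt0 v0) => a b c c0.
rewrite (_ : _ + _ = c * (a * c - b ^+ 2)); last by ring.
by rewrite pmulr_rge0// subr_ge0.
Qed.

Lemma enormD m (u v : 'cV[R]_m) : enorm (u + v) <= enorm u + enorm v.
Proof.
apply: enorm_le; first by rewrite addr_ge0 ?enorm_ge0.
rewrite dotDl !dotDr (dotC v u) sqrrD -!enorm_sqr.
have := dot_cauchy u v; have := ler_norm (dot u v); lra.
Qed.

Lemma enormB m (u v : 'cV[R]_m) : enorm (u - v) <= enorm u + enorm v.
Proof. by rewrite (le_trans (enormD _ _))// enormN. Qed.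

Lemma enorm_sum m n (v : 'I_n -> 'cV[R]_m) :
  enorm (\sum_j v j) <= \sum_j enorm (v j).
Proof.
elim/big_ind2 : _ => [|x1 x2 y1 y2 h1 h2|//]; first by rewrite enorm0.
by rewrite (le_trans (enormD _ _))// lerD.
Qed.

Lemma entry_le_enorm m (u : 'cV[R]_m) i : `|u i 0| <= enorm u.
Proof.
rewrite -(@ler_pXn2r _ 2) ?nnegrE ?enorm_ge0// enorm_sqr real_normK ?num_real//.
rewrite dotE (bigD1 i)//= -expr2 lerDl sumr_ge0// => j _.
by rewrite -expr2 sqr_ge0.
Qed.

(** Cauchy-Schwarz against the vector of ones; this is the origin of the factors n in C_P and
    C_Q. *)
Lemma sum_entry_le_enorm m (u : 'cV[R]_m) :
  \sum_i `|u i 0| <= Num.sqrt m%:R * enorm u.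
Proof.
have -> : \sum_i `|u i 0| = dot (const_mx 1) (\col_i `|u i 0|).
  by rewrite dotE; apply: eq_bigr => i _; rewrite !mxE mul1r.
apply: (le_trans (ler_norm _)); apply: (le_trans (dot_cauchy _ _)).
rewrite !enorm_dot !dotE.
rewrite (eq_bigr (fun=> 1)); last by move=> i _; rewrite mxE mulr1.
rewrite sumr_const card_ord ler_wpM2l ?sqrtr_ge0//.
rewrite (eq_bigr (fun i => u i 0 * u i 0))// => i _.
by rewrite mxE -expr2 real_normK ?num_real.
Qed.

(** A crude bound, needed so that the supremum in [opnorm] is over a bounded set and not a default
    value. *)
Lemma mulmx_enorm_bounded m p (A : 'M[R]_(m, p)) :
  exists2 k, 0 <= k & forall v, enorm (A *m v) <= k * enorm v.
Proof.
exists (\sum_j enorm (col j A)); first by rewrite sumr_ge0// => j _; rewrite enorm_ge0.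
move=> v; rewrite mulr_suml.
have -> : A *m v = \sum_j v j 0 *: col j A.
  apply/matrixP => i k; rewrite ord1 summxE mxE; apply: eq_bigr => j _.
  by rewrite !mxE mulrC.
apply: (le_trans (enorm_sum _)); apply: ler_sum => j _.
by rewrite enormZ mulrC ler_wpM2l ?enorm_ge0// entry_le_enorm.
Qed.

Lemma opnorm_bound m p (A : 'M[R]_(m, p)) v :
  enorm (A *m v) <= opnorm A * enorm v.
Proof.
have [->|v0] := eqVneq v 0; first by rewrite mulmx0 !enorm0 mulr0.
have nv0 : 0 < enorm v.
  rewrite lt_neqAle enorm_ge0 andbT eq_sym.
  by apply: contra_neq v0; exact: enorm_eq0.
rewrite -ler_pdivrMr//.
have -> : enorm (A *m v) / enorm v = enorm (A *m ((enorm v)^-1 *: v)).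
  by rewrite -scalemxAr enormZ ger0_norm ?invr_ge0 ?enorm_ge0// mulrC.
apply: ub_le_sup.
  have [k k0 Ak] := mulmx_enorm_bounded A.
  exists k => _ /= [w w1 <-]; rewrite (le_trans (Ak _))//.
  by rewrite -[leRHS]mulr1 ler_wpM2l.
exists ((enorm v)^-1 *: v) => //=.
by rewrite enormZ ger0_norm ?invr_ge0 ?enorm_ge0// mulVf ?gt_eqF.
Qed.

Lemma opnorm_ge0 m p (A : 'M[R]_(m, p)) : 0 <= opnorm A.
Proof.
apply: ub_le_sup; last by exists 0; rewrite /= ?mulmx0 enorm0 ?ler01.
have [k k0 Ak] := mulmx_enorm_bounded A.
exists k => _ /= [w w1 <-]; rewrite (le_trans (Ak _))//.
by rewrite -[leRHS]mulr1 ler_wpM2l.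
Qed.

End dot.

(** * Derivatives and limits of matrix-valued functions *)

Section derive_mx.
Variable R : realType.
Implicit Types m n p : nat.

Lemma is_derive_entry m n (f : R -> 'M[R]_(m, n)) (x : R) (df : 'M[R]_(m, n)) i j :
  is_derive x 1 f df -> is_derive x 1 (fun t => f t i j) (df i j).
Proof.
case=> fx fdf; apply: DeriveDef; first by move/derivable_mxP : fx; exact.
by rewrite -fdf (derive_mx fx) mxE.
Qed.

Lemma is_derive_mxP m n (f : R -> 'M[R]_(m, n)) (x : R) (df : 'M[R]_(m, n)) :
  (forall i j, is_derive x 1 (fun t => f t i j) (df i j)) -> is_derive x 1 f df.
Proof.
move=> fdf; have fx : derivable f x 1.
  by apply/derivable_mxP => i j; have [] := fdf i j.
apply: DeriveDef => //; rewrite (derive_mx fx); apply/matrixP => i j.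
by rewrite mxE; apply: derive_val.
Qed.

Lemma is_derive_bigsum n (h : 'I_n -> R -> R) (dh : 'I_n -> R) (x : R) :
  (forall i, is_derive x 1 (h i) (dh i)) ->
  is_derive x 1 (fun t => \sum_i h i t) (\sum_i dh i).
Proof.
move=> hh; have -> : (fun t => \sum_i h i t) = \sum_i h i.
  by apply/funext => t; rewrite fct_sumE.
exact: is_derive_sum.
Qed.

Lemma is_derive_mul (f g : R -> R) (x : R) df dg :
  is_derive x 1 f df -> is_derive x 1 g dg ->
  is_derive x 1 (fun t => f t * g t) (df * g x + f x * dg).
Proof.
move=> fd gd; rewrite [X in is_derive _ _ _ X](_ : _ = f x *: dg + g x *: df).
  exact: (is_deriveM fd gd).
by rewrite /GRing.scale/=; ring.
Qed.

Lemma is_derive_inj m (f g : R -> 'cV[R]_m) (x : R) (df dg : 'cV[R]_m) :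
  f = g -> is_derive x 1 f df -> is_derive x 1 g dg -> df = dg.
Proof. by move=> -> [_ <-] [_ <-]. Qed.

Lemma is_derive_mulmx m n (A : 'M[R]_(m, n)) (f : R -> 'cV[R]_n) (x : R) df :
  is_derive x 1 f df -> is_derive x 1 (fun t => A *m f t) (A *m df).
Proof.
move=> fdf; apply: is_derive_mxP => i j; rewrite mxE.
under eq_fun do rewrite mxE.
apply: is_derive_bigsum => k.
rewrite [X in is_derive _ _ _ X](_ : _ = 0 * f x k j + A i k * df k j).
  exact: (is_derive_mul (is_derive_cst _ _ _) (is_derive_entry k j fdf)).
by rewrite mul0r add0r.
Qed.

Lemma is_derive_dot m (f g : R -> 'cV[R]_m) (x : R) df dg :
  is_derive x 1 f df -> is_derive x 1 g dg ->
  is_derive x 1 (fun t => dot (f t) (g t)) (dot df (g x) + dot (f x) dg).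
Proof.
move=> fdf gdg; rewrite !dotE -big_split/=.
under eq_fun do rewrite dotE.
apply: is_derive_bigsum => i.
exact: (is_derive_mul (is_derive_entry i 0 fdf) (is_derive_entry i 0 gdg)).
Qed.

Lemma is_derive_usubmx m n (f : R -> 'cV[R]_(m + n)) (x : R) df :
  is_derive x 1 f df -> is_derive x 1 (fun t => usubmx (f t)) (usubmx df).
Proof.
move=> fdf; apply: is_derive_mxP => i j; rewrite mxE.
under eq_fun do rewrite mxE.
exact: is_derive_entry.
Qed.

Lemma is_derive_dsubmx m n (f : R -> 'cV[R]_(m + n)) (x : R) df :
  is_derive x 1 f df -> is_derive x 1 (fun t => dsubmx (f t)) (dsubmx df).
Proof.
move=> fdf; apply: is_derive_mxP => i j; rewrite mxE.
under eq_fun do rewrite mxE.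
exact: is_derive_entry.
Qed.

Lemma is_derive_continuous (f : R -> R) df (x : R) :
  is_derive x 1 f df -> {for x, continuous f}.
Proof. by case=> fx _; apply/differentiable_continuous/derivable1_diffP. Qed.

Lemma is_derive_nondecreasing (f df : R -> R) (a b : R) :
  a <= b -> (forall x, a <= x <= b -> is_derive x 1 f (df x)) ->
  (forall x, a <= x <= b -> 0 <= df x) -> f a <= f b.
Proof.
rewrite le_eqVlt => /predU1P[->//|ab] fd df0.
have [||c /= cab fab] := @MVT R f df a b ab.
- by move=> x /[!in_itv]/= /andP[ax xb]; apply: fd; rewrite !ltW.
- apply: continuous_in_subspaceT => x /[!inE]/= /[!in_itv]/= axb.
  exact: is_derive_continuous (fd _ axb).
rewrite -subr_ge0 fab mulr_ge0 ?subr_ge0 ?(ltW ab)// df0//.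
by move: cab; rewrite in_itv/= => /andP[/ltW -> /ltW ->].
Qed.

Lemma is_derive_MVT (f df : R -> R) (a b : R) :
  a <= b -> (forall x, a <= x <= b -> is_derive x 1 f (df x)) ->
  exists2 c, a <= c <= b & f b - f a = df c * (b - a).
Proof.
move=> ab fd; have [||c /= cab fab] := @MVT_segment R f df a b ab.
- by move=> x /[!in_itv]/= /andP[ax xb]; apply: fd; rewrite !ltW.
- apply: continuous_in_subspaceT => x /[!inE]/= /[!in_itv]/= axb.
  exact: is_derive_continuous (fd _ axb).
by exists c.
Qed.

Lemma is_derive_expRM (k x : R) :
  is_derive x 1 (fun t => expR (k * t) : R) (k * expR (k * x)).
Proof.
have h : is_derive x 1 (fun t => k * t) k.
  rewrite [X in is_derive _ _ _ X](_ : k = 0 * x + k * 1); last first.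
    by rewrite mul0r add0r mulr1.
  exact: (is_derive_mul (is_derive_cst _ _ _) (is_derive_id _ _)).
have := is_derive1_comp (is_derive_expR (k * x)) h.
by rewrite mulrC.
Qed.

Lemma cvg_mx_entry T (F : set_system T) {FF : Filter F} m n
  (f : T -> 'M[R]_(m, n)) (l : 'M[R]_(m, n)) i j :
  f x @[x --> F] --> l -> f x i j @[x --> F] --> l i j.
Proof.
move=> /cvgrPdist_le fl; apply/cvgrPdist_le => e e0.
near=> x; have := near (fl e e0) x.
move=> h; apply: (le_trans _ (h _)) => //.
rewrite [leRHS]/Num.Def.normr/= mx_normrE.
apply: le_trans; last exact: (le_bigmax _ _ (i, j)).
by rewrite /= !mxE.
Unshelve. all: by end_near. Qed.

Lemma cvg_mxP T (F : set_system T) {FF : Filter F} m n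
  (f : T -> 'M[R]_(m, n)) (l : 'M[R]_(m, n)) :
  (forall i j, f x i j @[x --> F] --> l i j) -> f x @[x --> F] --> l.
Proof.
move=> fl; apply/cvgrPdist_le => e e0.
near=> x.
rewrite /Num.Def.normr/= mx_normrE (bigmax_le _ (ltW e0))//= => i _.
rewrite !mxE/=.
move: i; near: x; apply: filter_forall => /= i.
exact: ((cvgrPdist_le _ _).1 (fl i.1 i.2)).
Unshelve. all: by end_near. Qed.

Lemma cvg_bigsum T (F : set_system T) {FF : Filter F} n (f : 'I_n -> T -> R) (l : 'I_n -> R) :
  (forall i, f i x @[x --> F] --> l i) ->
  \sum_i f i x @[x --> F] --> \sum_i l i.
Proof.
elim: n f l => [|n IH] f l fl.
  rewrite big_ord0; have -> : (fun x => \sum_(i < 0) f i x) = cst 0.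
    by apply/funext => x; rewrite big_ord0.
  exact: cvg_cst.
rewrite big_ord_recr/=.
have -> : (fun x => \sum_(i < n.+1) f i x) =
    (fun x => \sum_(i < n) f (widen_ord (leqnSn n) i) x) \+ f ord_max.
  by apply/funext => x; rewrite big_ord_recr.
by apply: cvgD; [exact: IH | exact: fl].
Qed.

Lemma cvg_dot T (F : set_system T) {FF : Filter F} m
  (f g : T -> 'cV[R]_m) (l k : 'cV[R]_m) :
  f x @[x --> F] --> l -> g x @[x --> F] --> k ->
  dot (f x) (g x) @[x --> F] --> dot l k.
Proof.
move=> fl gk; under eq_fun do rewrite dotE.
rewrite dotE; apply: cvg_bigsum => i.
by apply: cvgM; apply: cvg_mx_entry.
Qed.

Lemma cvg_usubmx T (F : set_system T) {FF : Filter F} m n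
  (f : T -> 'cV[R]_(m + n)) (l : 'cV[R]_(m + n)) :
  f x @[x --> F] --> l -> usubmx (f x) @[x --> F] --> usubmx l.
Proof.
move=> fl; apply: cvg_mxP => i j; rewrite mxE; under eq_fun do rewrite mxE.
exact: cvg_mx_entry.
Qed.

Lemma cvg_dsubmx T (F : set_system T) {FF : Filter F} m n
  (f : T -> 'cV[R]_(m + n)) (l : 'cV[R]_(m + n)) :
  f x @[x --> F] --> l -> dsubmx (f x) @[x --> F] --> dsubmx l.
Proof.
move=> fl; apply: cvg_mxP => i j; rewrite mxE; under eq_fun do rewrite mxE.
exact: cvg_mx_entry.
Qed.

Lemma cvg0_enorm_le T (F : set_system T) {FF : Filter F} m
  (f : T -> 'cV[R]_m) (g : T -> R) :
  (\forall x \near F, enorm (f x) <= g x) -> g x @[x --> F] --> 0 ->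
  f x @[x --> F] --> (0 : 'cV[R]_m).
Proof.
move=> fg g0; apply: cvg_mxP => i j; rewrite ord1 mxE.
apply: norm_cvg0; apply: (@squeeze_cvgr _ _ _ _ (cst 0) g) => //; last exact: cvg_cst.
near=> x; rewrite normr_ge0/=.
apply: (le_trans (entry_le_enorm _ _)); near: x; exact: fg.
Unshelve. all: by end_near. Qed.

End derive_mx.

Arguments cvg_mx_entry {R T F FF m n f l} i j.

(** * Chain rule for functions with continuous partial derivatives *)

Section chain_rule.
Variables (R : realType) (n : nat).
Implicit Types (f : 'cV[R]_n -> R) (v y : 'cV[R]_n).

Lemma is_derive_lipschitz (f df : R -> R) (a b e : R) :
  (forall x, Num.min a b <= x <= Num.max a b ->
    is_derive x 1 f (df x) /\ `|df x| <= e) ->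
  `|f b - f a| <= e * `|b - a|.
Proof.
wlog ab : a b / a <= b.
  move=> h fd; have [ab|/ltW ba] := leP a b; first exact: h.
  by rewrite distrC (distrC b); apply: h => // x xba; apply: fd; rewrite minC maxC.
move=> fd; rewrite (min_l ab) (max_r ab) in fd.
have [x axb ->] := is_derive_MVT ab (fun x h => (fd x h).1).
by rewrite normrM ler_wpM2r//; case: (fd x axb).
Qed.

Lemma is_derive_line f a w (s : R) : derivable f (a + s *: w) w ->
  is_derive s 1 (fun t : R => f (a + t *: w)) ('D_w f (a + s *: w)).
Proof.
have E : (fun h : R => h^-1 *: (((fun t : R => f (a + t *: w)) \o shift s) (h *: 1)
             - f (a + s *: w))) =
  (fun h : R => h^-1 *: ((f \o shift (a + s *: w)) (h *: w) - f (a + s *: w))).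
  apply/funext => h /=; congr (_ *: (f _ - _)).
  by rewrite [h *: 1]mulr1 scalerDl addrCA.
by move=> fd; apply: DeriveDef; rewrite /derivable /derive E.
Qed.

(** Move from v to y one coordinate at a time. Balls are those of the entrywise maximum norm, so
    every intermediate segment stays inside the ball. *)
Lemma pd1_lipschitz f v (r e : R) :
  (forall j y, derivable f y (delta_mx j 0)) ->
  (forall j y, ball v r y -> `|pd1 f j y| <= e) ->
  forall y, ball v r y -> `|f y - f v| <= e * \sum_j `|y j 0 - v j 0|.
Proof.
move=> fd fe y yv.
(* The k-th corner of the path: the first k coordinates are already those of y. *)
pose P (k : nat) : 'cV[R]_n := \col_i (if (i < k)%N then y i 0 else v i 0).
have P0 : P 0 = v by apply/matrixP => i j; rewrite mxE ord1.
have Pn : P n = y by apply/matrixP => i j; rewrite mxE ltn_ord ord1.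
rewrite -{1}P0 -{1}Pn -(@telescope_sumr _ 0 n (f \o P))// big_mkord.
apply: (le_trans (ler_norm_sum _ _ _)); rewrite mulr_sumr; apply: ler_sum => k _ /=.
set t := y k 0 - v k 0.
have Pk s : P k + s *: delta_mx k 0 =
    \col_i (if i == k then v k 0 + s else P k i 0).
  apply/matrixP => i j; rewrite ord1 !mxE eqxx andbT.
  by have [->|ik] := eqVneq i k; rewrite ?ltnn ?mulr1// mulr0 addr0.
have PkS : P k.+1 = P k + t *: delta_mx k 0.
  rewrite Pk; apply/matrixP => i j; rewrite ord1 !mxE ltnS leq_eqVlt.
  have [->|ik] := eqVneq i k; first by rewrite eqxx/= addrC subrK.
  by rewrite (inj_eq val_inj) (negbTE ik).
have yvE i : `|v i 0 - y i 0| < r.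
  by case: yv => r0 yv; exact: yv.
have r0 : 0 < r by apply: le_lt_trans (yvE k).
rewrite PkS -[in X in _ - f X](addr0 (P k)) -{1}(scale0r (delta_mx k 0)).
rewrite -[X in _ * `|X|]subr0.
apply: (@is_derive_lipschitz (fun s => f (P k + s *: delta_mx k 0))
  (fun s => pd1 f k (P k + s *: delta_mx k 0))) => s st.
split; first exact: is_derive_line.
apply: fe; split=> // i j; rewrite ord1 Pk !mxE.
have [->|ik] := eqVneq i k; last first.
  case: ifPn => _; first exact: yvE.
  exact: ballxx.
rewrite /ball/= (_ : _ - _ = - s) ?normrN; last by ring.
apply: le_lt_trans (yvE k); rewrite distrC -/t.
by move: st; case: (leP 0 t) => t0 /andP[s0 s1];
  [rewrite (ger0_norm t0) | rewrite (ltr0_norm t0)]; rewrite ler_norml; apply/andP; split; lra.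
Qed.

Lemma is_derive_dotr (c y w : 'cV[R]_n) : is_derive y w (dot c) (dot c w).
Proof.
have H : h^-1 *: ((dot c \o shift y) (h *: w) - dot c y) @[h --> 0^'] --> dot c w.
  apply: cvg_near_cst; near=> h.
  rewrite /= dotDr dotZr addrK /GRing.scale/= mulrA mulVf ?mul1r//.
  by near: h; exact: nbhs_dnbhs_neq.
by apply: DeriveDef; [exact: cvgP H | exact: cvg_lim H].
Unshelve. all: by end_near. Qed.

(** [C2] supplies partial derivatives, not differentiability. Subtracting the linear form [dot c]
    with the partials at phi x leaves a function g whose partials are small near phi x; by
    [pd1_lipschitz] g contributes 0 to the difference quotient, and the linear form contributes the
    sum. *)
Lemma is_derive_pd1_comp f (phi : R -> 'cV[R]_n) (x : R) (dphi : 'cV[R]_n) :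
  (forall j y, derivable f y (delta_mx j 0)) ->
  (forall j, continuous (pd1 f j)) ->
  is_derive x 1 phi dphi ->
  is_derive x 1 (f \o phi) (\sum_j pd1 f j (phi x) * dphi j 0).
Proof.
move=> fd fc phid.
pose c : 'cV[R]_n := \col_j pd1 f j (phi x).
pose g := f - dot c.
have gd j y : derivable g y (delta_mx j 0).
  by apply: derivableB => //; case: (is_derive_dotr c y (delta_mx j 0)).
have gE j y : pd1 g j y = pd1 f j y - c j 0.
  rewrite /pd1 deriveB//; last by case: (is_derive_dotr c y (delta_mx j 0)).
  by case: (is_derive_dotr c y (delta_mx j 0)) => _ ->; rewrite dotC dot_delta.
have phi_diff j : (h^-1 * (phi (h + x) j 0 - phi x j 0)) @[h --> 0^'] --> dphi j 0.
  have [phij <-] := is_derive_entry j 0 phid.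
  have := phij; rewrite /derivable /derive.
  by under eq_fun do rewrite /= [_ *: 1]mulr1.
have phi_cont : phi (h + x) @[h --> 0^'] --> phi x.
  have hx : (h + x) @[h --> 0^'] --> x.
    rewrite -[X in _ --> X]add0r; apply: cvgD; last exact: cvg_cst.
    by move=> A; exact: nbhs_dnbhs.
  apply: (cvg_comp _ _ hx); apply: cvg_mxP => i j; rewrite ord1.
  exact: is_derive_continuous (is_derive_entry i 0 phid).
have key : (h^-1 * (g (phi (h + x)) - g (phi x))) @[h --> 0^'] --> 0.
  apply/cvgrPdist_le => e e0.
  (* Near h = 0 each difference quotient of phi is at most |phi'_j| + 1 in absolute value, and S
     exceeds the sum of these bounds; the last + 1 keeps S positive even for an empty sum. *)
  pose S := \sum_j (`|dphi j 0| + 1) + 1.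
  have S0 : 0 < S by rewrite ltr_wpDl// sumr_ge0// => j _; rewrite addr_ge0.
  have [r r0 rg] : exists2 r : R, 0 < r &
      forall j y, ball (phi x) r y -> `|pd1 g j y| <= e / S.
    have : \forall y \near phi x, forall j, `|pd1 g j y| <= e / S.
      have H j : \forall y \near phi x, `|pd1 g j y| <= e / S.
        near=> y; rewrite gE distrC mxE; near: y.
        exact: ((cvgrPdist_le _ _).1 (fc j (phi x)) _ (divr_gt0 e0 S0)).
      exact: (@filter_forall _ _ _ _ (nbhs_filter (phi x)) H).
    by move=> /nbhs_ballP[r /= r0 rg]; exists r => // j y /rg.
  have dhN : \forall h \near 0^', forall j,
      `|h^-1 * (phi (h + x) j 0 - phi x j 0)| <= `|dphi j 0| + 1.
    apply: filter_forall => j; near=> k.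
    rewrite -lerBlDl (le_trans (lerB_dist _ _))// distrC; near: k.
    exact: ((cvgrPdist_le _ _).1 (phi_diff j) _ ltr01).
  near=> h.
  rewrite sub0r normrN normrM.
  have gh : `|g (phi (h + x)) - g (phi x)| <=
      e / S * \sum_j `|phi (h + x) j 0 - phi x j 0|.
    apply: (pd1_lipschitz gd rg); near: h.
    exact: (phi_cont _ (nbhsx_ballx _ _ r0)).
  have dh : forall j, `|h^-1 * (phi (h + x) j 0 - phi x j 0)| <= `|dphi j 0| + 1.
    by near: h.
  apply: (@le_trans _ _ (e / S * \sum_j (`|dphi j 0| + 1))).
    rewrite (le_trans (ler_wpM2l (normr_ge0 _) gh))// mulrCA ler_wpM2l//.
      by rewrite divr_ge0// ltW.
    by rewrite mulr_sumr; apply: ler_sum => j _; rewrite -normrM; exact: dh.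
  rewrite -mulrA ler_piMr ?(ltW e0)// mulrC ler_pdivrMr// mul1r.
  by rewrite lerDl.
have H : h^-1 *: (((f \o phi) \o shift x) (h *: 1) - (f \o phi) x) @[h --> 0^']
    --> \sum_j pd1 f j (phi x) * dphi j 0.
  have -> : (fun h : R => h^-1 *: (((f \o phi) \o shift x) (h *: 1) - (f \o phi) x)) =
    (fun h => h^-1 * (g (phi (h + x)) - g (phi x))) \+
    (fun h => \sum_j c j 0 * (h^-1 * (phi (h + x) j 0 - phi x j 0))).
    apply/funext => h /=; rewrite [h *: 1]mulr1 /g /= !fctE !dotE.
    under [X in _ = _ + X]eq_bigr do rewrite mulrCA mulrBr.
    by rewrite -mulr_sumr sumrB -mulrDr /GRing.scale/=; congr (_ * _); ring.
  rewrite -[X in _ --> X]add0r; apply: cvgD => //.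
  apply: cvg_bigsum => j; have -> : pd1 f j (phi x) = c j 0 by rewrite mxE.
  exact: cvgM (cvg_cst _) (phi_diff j).
by apply: DeriveDef; [exact: cvgP H | exact: cvg_lim H].
Unshelve. all: by end_near. Qed.

End chain_rule.

(** * The linear system and its symplectic form *)

Section linear_system.
Variables (R : realType) (n : nat) (d : 'rV[R]_n).
Hypothesis d_gt0 : forall j, 0 < d 0 j.
Implicit Types (M : R -> 'M[R]_n) (U V : R -> 'cV[R]_(n + n)).

Lemma diag_mx_unit (e : 'rV[R]_n) : (forall j, 0 < e 0 j) -> diag_mx e \in unitmx.
Proof.
move=> e0; rewrite unitmxE det_diag unitfE; apply/prodf_neq0 => j _.
by rewrite gt_eqF.
Qed.

Lemma invmx_diag (e : 'rV[R]_n) : (forall j, 0 < e 0 j) ->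
  invmx (diag_mx e) = diag_mx (map_mx GRing.inv e).
Proof.
move=> e0; apply: (can_inj (mulKmx (diag_mx_unit e0))).
rewrite mulmxV ?diag_mx_unit// mulmx_diag -diag_const_mx; congr diag_mx.
by apply/matrixP => i j; rewrite ord1 !mxE mulfV// gt_eqF.
Qed.

Lemma sysmxE (A : 'M[R]_n) (v : 'cV[R]_(n + n)) : sysmx d A *m v =
  col_mx (invmx (diag_mx d) *m dsubmx v) (- A *m usubmx v).
Proof.
by rewrite -{1}(vsubmxK v) /sysmx mul_block_col !mul0mx add0r addr0.
Qed.

Lemma is_derive_col_mx m p (f : R -> 'cV[R]_m) (g : R -> 'cV[R]_p) (x : R) (df : 'cV[R]_m) (dg : 'cV[R]_p) :
  is_derive x 1 f df -> is_derive x 1 g dg ->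
  is_derive x 1 (fun t => col_mx (f t) (g t)) (col_mx df dg).
Proof.
move=> fd gd; apply: is_derive_mxP => i j.
under eq_fun do rewrite mxE; rewrite mxE.
by case: (fintype.split i) => k; exact: is_derive_entry.
Qed.

Lemma is_solutionP M U : is_solution d M U <-> forall x : R,
  is_derive x 1 (fun t => usubmx (U t)) (invmx (diag_mx d) *m dsubmx (U x)) /\
  is_derive x 1 (fun t => dsubmx (U t)) (- M x *m usubmx (U x)).
Proof.
split=> [Us x|Us x].
  have := Us x; rewrite sysmxE => Ux; split.
    by have := is_derive_usubmx Ux; rewrite col_mxKu.
  by have := is_derive_dsubmx Ux; rewrite col_mxKd.
have [u w] := Us x; have := is_derive_col_mx u w; rewrite -sysmxE.
by congr is_derive; apply/funext => t; rewrite vsubmxK.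
Qed.

Lemma solution0 M : is_solution d M (fun=> 0).
Proof. by move=> x; rewrite mulmx0; exact: is_derive_cst. Qed.

Lemma solutionD M U V : is_solution d M U -> is_solution d M V ->
  is_solution d M (fun x => U x + V x).
Proof. by move=> Us Vs x; rewrite mulmxDr; exact: is_deriveD. Qed.

Lemma solutionZ M a U : is_solution d M U -> is_solution d M (fun x => a *: U x).
Proof. by move=> Us x; rewrite -scalemxAr; exact: is_deriveZ. Qed.

Lemma solution_sum M p (c : 'I_p -> R) (U : 'I_p -> R -> 'cV[R]_(n + n)) :
  (forall j, is_solution d M (U j)) ->
  is_solution d M (fun x => \sum_j c j *: U j x).
Proof.
elim: p c U => [|p IH] c U Us.
  under eq_fun do rewrite big_ord0; exact: solution0.
under eq_fun do rewrite big_ord_recr/=.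
by apply: solutionD; [exact: IH|exact: solutionZ].
Qed.

Definition omega (U V : 'cV[R]_(n + n)) : R :=
  dot (usubmx U) (dsubmx V) - dot (dsubmx U) (usubmx V).

Lemma omegaDr (U V W : 'cV[R]_(n + n)) : omega U (V + W) = omega U V + omega U W.
Proof. by rewrite /omega !linearD !dotDr; ring. Qed.

Lemma omegaZr a (U V : 'cV[R]_(n + n)) : omega U (a *: V) = a * omega U V.
Proof. by rewrite /omega !linearZ !dotZr; ring. Qed.

Lemma omegaC (U V : 'cV[R]_(n + n)) : omega U V = - omega V U.
Proof. by rewrite /omega (dotC (usubmx U)) (dotC (dsubmx U)); ring. Qed.

Lemma omegaDl (U V W : 'cV[R]_(n + n)) : omega (V + W) U = omega V U + omega W U.
Proof. by rewrite 3!(omegaC _ U) omegaDr opprD. Qed.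

Lemma omegaZl a (U V : 'cV[R]_(n + n)) : omega (a *: U) V = a * omega U V.
Proof. by rewrite 2!(omegaC _ V) omegaZr mulrN. Qed.

Lemma omega0r (U : 'cV[R]_(n + n)) : omega U 0 = 0.
Proof. by rewrite -(scale0r 0) omegaZr mul0r. Qed.

Lemma omega_sumr p (U : 'cV[R]_(n + n)) (V : 'I_p -> 'cV[R]_(n + n)) :
  omega U (\sum_j V j) = \sum_j omega U (V j).
Proof. by apply: (big_morph (omega U)) => [x y|]; rewrite ?omegaDr ?omega0r. Qed.

Lemma omega_suml p (U : 'cV[R]_(n + n)) (V : 'I_p -> 'cV[R]_(n + n)) :
  omega (\sum_j V j) U = \sum_j omega (V j) U.
Proof.
rewrite omegaC omega_sumr -sumrN; apply: eq_bigr => j _; by rewrite -omegaC.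
Qed.

Lemma dot_vsubmx (U V : 'cV[R]_(n + n)) :
  dot U V = dot (usubmx U) (usubmx V) + dot (dsubmx U) (dsubmx V).
Proof. by rewrite -dot_col_mx !vsubmxK. Qed.

Lemma enorm_usubmx (U : 'cV[R]_(n + n)) : enorm (usubmx U) <= enorm U.
Proof.
by rewrite !enorm_dot ler_wsqrtr// (dot_vsubmx U) lerDl dot_ge0.
Qed.

Lemma enorm_dsubmx (U : 'cV[R]_(n + n)) : enorm (dsubmx U) <= enorm U.
Proof.
by rewrite !enorm_dot ler_wsqrtr// (dot_vsubmx U) lerDr dot_ge0.
Qed.

Lemma enorm_col_mx (u w : 'cV[R]_n) : enorm (col_mx u w) <= enorm u + enorm w.
Proof.
apply: enorm_le; first by rewrite addr_ge0 ?enorm_ge0.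
rewrite dot_col_mx sqrrD -!enorm_sqr.
have := mulr_ge0 (enorm_ge0 u) (enorm_ge0 w); lra.
Qed.

(** The form is the scalar product of U with the image of V under an isometry. *)
Lemma omega_le (U V : 'cV[R]_(n + n)) : `|omega U V| <= enorm U * enorm V.
Proof.
have -> : omega U V = dot U (col_mx (dsubmx V) (- usubmx V)).
  by rewrite dot_vsubmx col_mxKu col_mxKd dotNr.
apply: (le_trans (dot_cauchy _ _)); rewrite ler_wpM2l ?enorm_ge0//.
rewrite !enorm_dot dot_col_mx (dot_vsubmx V) dotNl dotNr opprK addrC.
exact: lexx.
Qed.

Lemma omega_const M U V : (forall x, (M x)^T = M x) ->
  is_solution d M U -> is_solution d M V ->
  forall x y, omega (U x) (V x) = omega (U y) (V y).
Proof.
move=> Msym /is_solutionP Us /is_solutionP Vs x y.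
apply: (@is_derive_0_is_cst _ (fun t => omega (U t) (V t))) => t.
have [uU wU] := Us t; have [uV wV] := Vs t.
rewrite [X in is_derive _ _ _ X](_ : _ =
    (dot (invmx (diag_mx d) *m dsubmx (U t)) (dsubmx (V t)) +
     dot (usubmx (U t)) (- M t *m usubmx (V t))) -
    (dot (- M t *m usubmx (U t)) (usubmx (V t)) +
     dot (dsubmx (U t)) (invmx (diag_mx d) *m dsubmx (V t)))); last first.
  rewrite !dot_mulmxl linearN/= Msym invmx_diag// tr_diag_mx.
  by rewrite !mulNmx !dotNr; ring.
exact: (is_deriveB (is_derive_dot uU wV) (is_derive_dot wU uV)).
Qed.

(** Gronwall in both directions: the derivative of |U|^2 is at most 2k |U|^2 in absolute value, so
    |U|^2 e^(-2kx) does not increase and |U|^2 e^(2kx) does not decrease. *)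
Lemma solution_growth M (k : R) U :
  (forall x (v : 'cV[R]_(n + n)), enorm (sysmx d (M x) *m v) <= k * enorm v) ->
  is_solution d M U -> forall x y, x <= y ->
  dot (U y) (U y) * expR (- 2 * k * y) <= dot (U x) (U x) * expR (- 2 * k * x) /\
  dot (U x) (U x) * expR (2 * k * x) <= dot (U y) (U y) * expR (2 * k * y).
Proof.
move=> Mk Us x y xy.
have expd (s t : R) : is_derive t 1 (fun t => dot (U t) (U t) * expR (s * t))
   ((2 * dot (U t) (sysmx d (M t) *m U t) + s * dot (U t) (U t)) * expR (s * t)).
  rewrite [X in is_derive _ _ _ X](_ : _ =
    (dot (sysmx d (M t) *m U t) (U t) + dot (U t) (sysmx d (M t) *m U t)) * expR (s * t)
    + dot (U t) (U t) * (s * expR (s * t))); last first.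
    by rewrite (dotC (_ *m _)); ring.
  exact: (is_derive_mul (is_derive_dot (Us t) (Us t)) (is_derive_expRM _ _)).
have Uk t : `|dot (U t) (sysmx d (M t) *m U t)| <= k * dot (U t) (U t).
  apply: (le_trans (dot_cauchy _ _)).
  by rewrite -enorm_sqr expr2 mulrCA ler_wpM2l ?enorm_ge0.
split.
  rewrite -lerN2.
  apply: (is_derive_nondecreasing xy (fun t _ => is_deriveN (expd (- 2 * k) t))) => t _.
  rewrite -mulNr mulr_ge0 ?expR_ge0//.
  have := Uk t; rewrite ler_norml => /andP[]; lra.
apply: (is_derive_nondecreasing xy (fun t _ => expd (2 * k) t)) => t _.
rewrite mulr_ge0 ?expR_ge0//.
have := Uk t; rewrite ler_norml => /andP[]; lra.
Qed.

Lemma solution_unique M (k : R) :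
  (forall x (v : 'cV[R]_(n + n)), enorm (sysmx d (M x) *m v) <= k * enorm v) ->
  forall U V x0, is_solution d M U -> is_solution d M V -> U x0 = V x0 ->
  forall x, U x = V x.
Proof.
move=> Mk U V x0 Us Vs UV0 x; apply/eqP; rewrite -subr_eq0; apply/eqP.
pose W x := U x + -1 *: V x.
have Ws : is_solution d M W by apply: solutionD => //; exact: solutionZ.
have W0 : W x0 = 0 by rewrite /W UV0 scaleN1r subrr.
suff: W x = 0 by rewrite /W scaleN1r.
apply: dot_eq0; apply/eqP; rewrite eq_le dot_ge0 andbT.
have [xx0|/ltW x0x] := leP x x0.
  have [_] := solution_growth Mk Ws xx0.
  by rewrite W0 dot0l mul0r pmulr_lle0 ?expR_gt0.
have [+ _] := solution_growth Mk Ws x0x.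
by rewrite W0 dot0l mul0r pmulr_lle0 ?expR_gt0.
Qed.

(** One constant on the whole line for two purposes: the bound on M controls u'' in L^2, the bound
    on the system matrix feeds the Gronwall estimate. *)
Lemma sysmx_bounded M M_m M_p C :
  (forall x, 0 <= x -> opnorm (M x - M_p) <= C) ->
  (forall x, x <= 0 -> opnorm (M x - M_m) <= C) ->
  exists2 k, 0 <= k & forall x,
    (forall v : 'cV[R]_n, enorm (M x *m v) <= k * enorm v) /\
    (forall v : 'cV[R]_(n + n), enorm (sysmx d (M x) *m v) <= k * enorm v).
Proof.
move=> Mp Mm.
have [kp kp0 Kp] := mulmx_enorm_bounded M_p.
have [km km0 Km] := mulmx_enorm_bounded M_m.
have [kd kd0 Kd] := mulmx_enorm_bounded (invmx (diag_mx d)).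
have C0 : 0 <= C by apply: le_trans (opnorm_ge0 _) (Mp 0 (lexx 0)).
have MU x (v : 'cV[R]_n) : enorm (M x *m v) <= (C + kp + km) * enorm v.
  have h A : opnorm (M x - A) <= C -> enorm (M x *m v) <= C * enorm v + enorm (A *m v).
    move=> MC; rewrite -[in leLHS](subrK A (M x)) mulmxDl.
    apply: (le_trans (enormD _ _)); rewrite lerD2r.
    by apply: (le_trans (opnorm_bound _ _)); rewrite ler_wpM2r ?enorm_ge0.
  have := Kp v; have := Km v; have := mulr_ge0 kp0 (enorm_ge0 v).
  have := mulr_ge0 km0 (enorm_ge0 v).
  by have [x0|/ltW x0] := leP 0 x; [have := h _ (Mp x x0)|have := h _ (Mm x x0)]; lra.
exists (C + kp + km + kd); first by rewrite !addr_ge0.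
move=> x; split=> v.
  by apply: (le_trans (MU x v)); rewrite ler_wpM2r ?enorm_ge0// lerDl.
rewrite sysmxE; apply: (le_trans (enorm_col_mx _ _)).
rewrite addrC mulrDl lerD//.
  rewrite mulNmx enormN (le_trans (MU _ _))// ler_wpM2l ?enorm_usubmx//.
  by rewrite !addr_ge0.
by rewrite (le_trans (Kd _))// ler_wpM2l ?enorm_dsubmx.
Qed.

End linear_system.

(** * The stationary solution *)

Section stationary.
Variables (R : realType) (n : nat) (d : 'rV[R]_n).
Hypothesis d_gt0 : forall j, 0 < d 0 j.
Variables (G : 'cV[R]_n -> R) (phi : R -> 'cV[R]_n).
Hypotheses (GC2 : C2 G) (phi_stat : stationary_solution d G phi).

Lemma is_derive_phi x : is_derive x (1 : R) phi (derive1 phi x).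
Proof. by have [h _ _] := phi_stat x; rewrite derive1E; exact/derivableP. Qed.

Lemma is_derive_phi' x : is_derive x (1 : R) (derive1 phi) (derive1 (derive1 phi) x).
Proof.
by have [_ h _] := phi_stat x; rewrite [X in is_derive _ _ _ X]derive1E; exact/derivableP.
Qed.

Lemma phi''E x : diag_mx d *m derive1 (derive1 phi) x = - gradient G (phi x).
Proof. by have [_ _ /eqP] := phi_stat x; rewrite addr_eq0 => /eqP. Qed.

(** A third derivative of phi is not assumed; D phi'' is differentiable because it equals - grad
    G(phi), to which the chain rule applies. *)
Lemma Uphi_solution M : (forall x, M x = hessian G (phi x)) ->
  is_solution d M (Uphi d phi).
Proof.
move=> ME; apply/is_solutionP => x; split.
  rewrite /Uphi col_mxKd mulKmx ?diag_mx_unit//.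
  under eq_fun do rewrite col_mxKu.
  exact: is_derive_phi'.
under eq_fun do rewrite /Uphi col_mxKd phi''E.
rewrite mulNmx; apply: is_deriveN; apply: is_derive_mxP => i j.
under eq_fun do rewrite mxE.
rewrite ord1 /Uphi col_mxKu.
rewrite [X in is_derive _ _ _ X](_ : _ =
  \sum_k pd1 (pd1 G i) k (phi x) * derive1 phi x k 0); last first.
  by rewrite mxE; apply: eq_bigr => k _; rewrite ME mxE.
have [_ _ _ Gd Gc] := GC2.
by apply: is_derive_pd1_comp; [exact: Gd|exact: Gc|exact: is_derive_phi].
Qed.

Lemma enorm_le_sum m (u : 'cV[R]_m) : enorm u <= \sum_i `|u i 0|.
Proof.
have {1}-> : u = \sum_i u i 0 *: delta_mx i 0.
  apply/matrixP => i j; rewrite ord1 summxE (bigD1 i)//= big1 ?addr0.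
    by rewrite !mxE !eqxx mulr1.
  by move=> k ki; rewrite !mxE eq_sym (negbTE ki) mulr0.
apply: (le_trans (enorm_sum _)); apply: ler_sum => i _.
by rewrite enormZ (enorm_dot (delta_mx _ _)) dot_delta mxE !eqxx sqrtr1 mulr1.
Qed.

(** Near +oo, D phi'' = - grad G(phi) is bounded since phi converges, and phi' is then controlled by
    increments of phi. Boundedness is all that [bounded_solution_Vts] asks for. *)
Lemma Uphi_bounded (phi_p : 'cV[R]_n) : phi x @[x --> +oo] --> phi_p ->
  exists C : R, \forall x \near +oo, enorm (Uphi d phi x) <= C.
Proof.
move=> phicv.
have gradcv i : pd1 G i (phi x) @[x --> +oo] --> pd1 G i phi_p.
  by apply: (cvg_comp _ _ phicv); have [_ _ h _ _] := GC2; exact: h.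
have bnd (f : R -> R) (l : R) : f x @[x --> +oo] --> l ->
    \forall x \near +oo, `|f x| <= `|l| + 1.
  move=> fl; near=> x; rewrite -lerBlDl (le_trans (lerB_dist _ _))// distrC.
  by near: x; exact: ((cvgrPdist_le _ _).1 fl _ ltr01).
have entry i : exists c : R,
    \forall x \near +oo, `|derive1 phi x i 0| <= c /\
      `|(diag_mx d *m derive1 (derive1 phi) x) i 0| <= c.
  pose b : R := `|pd1 G i phi_p| + 1; pose b' : R := `|phi_p i 0| + 1.
  have b0 : 0 <= b by rewrite addr_ge0.
  have b'0 : 0 <= b' by rewrite addr_ge0.
  have d0 : 0 <= (d 0 i)^-1 by rewrite invr_ge0 ltW.
  exists (b + (b' + b') + (d 0 i)^-1 * b).
  have [A [_ HA]] := filterI (bnd _ _ (gradcv i)) (bnd _ _ (cvg_mx_entry i 0 phicv)).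
  near=> x; split; last first.
    rewrite phi''E !mxE normrN (@le_trans _ _ b)//.
      by have [] := HA x _; [near: x; apply: nbhs_pinfty_gt; rewrite num_real|].
    by rewrite -addrA lerDl !addr_ge0// mulr_ge0.
  have Ax : A < x by near: x; apply: nbhs_pinfty_gt; rewrite num_real.
  have x1 : x <= x + 1 by rewrite lerDl.
  (* The mean value theorem on [x, x + 1] bounds phi' at some c; a second use on [x, c], with phi''
     bounded, carries the bound back to x. *)
  have [c /andP[xc cx1]] := is_derive_MVT x1
    (fun t _ => is_derive_entry i 0 (is_derive_phi t)).
  rewrite [X in _ * X](_ : _ = 1) ?mulr1; last by ring.
  move=> cE.
  have [y /andP[xy yc]] := is_derive_MVT xc
    (fun t _ => is_derive_entry i 0 (is_derive_phi' t)).
  move=> yE.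
  have y'b : `|derive1 (derive1 phi) y i 0| <= (d 0 i)^-1 * b.
    have -> : derive1 (derive1 phi) y i 0 = (d 0 i)^-1 * - pd1 G i (phi y).
      have /matrixP/(_ i 0) := phi''E y; rewrite mul_diag_mx !mxE => <-.
      by rewrite mulKf// gt_eqF.
    rewrite normrM normrN ger0_norm// ler_wpM2l//.
    by have [] := HA y (lt_le_trans Ax xy).
  have [_ p1] := HA x Ax; have [_ p2] := HA (x + 1) (lt_le_trans Ax x1).
  have -> : derive1 phi x i 0 = phi (x + 1) i 0 - phi x i 0 - derive1 (derive1 phi) y i 0 * (c - x).
    by rewrite cE -yE subKr.
  apply: (le_trans (ler_normB _ _)).
  rewrite lerD//.
    by rewrite (le_trans (ler_normB _ _))// -[leLHS]add0r lerD// lerD.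
  rewrite normrM -[leRHS]mulr1 ler_pM//.
  by rewrite ger0_norm ?subr_ge0// lerBlDl.
have {entry}[c Hc] := choice entry.
exists (\sum_i (c i + c i)).
near=> x.
apply: (le_trans (enorm_col_mx _ _)).
rewrite big_split lerD//; apply: (le_trans (enorm_le_sum _)); apply: ler_sum => i _.
  have : forall i, `|derive1 phi x i 0| <= c i.
    near: x; apply: filter_forall => k; apply: filterS (Hc k) => x []//.
  exact.
have : forall i, `|(diag_mx d *m derive1 (derive1 phi) x) i 0| <= c i.
  near: x; apply: filter_forall => k; apply: filterS (Hc k) => x []//.
exact.
Unshelve. all: by end_near. Qed.

End stationary.

(** * Quadratic forms on the unit sphere *)

Section quadratic_forms.
Variable R : realType.
Implicit Types m : nat.

Lemma quad_continuous m (B : 'M[R]_m) :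
  continuous (fun c : 'rV[R]_m => dot c^T (B *m c^T)).
Proof.
move=> c; have FF : Filter (nbhs c) := nbhs_filter c.
apply: cvg_dot.
  apply: cvg_mxP => i j; rewrite mxE; under eq_fun do rewrite mxE.
  exact: coord_continuous.
apply: cvg_mxP => i j; rewrite mxE; under eq_fun do rewrite mxE.
apply: cvg_bigsum => k; apply: cvgM; first exact: cvg_cst.
rewrite mxE; under eq_fun do rewrite mxE.
exact: coord_continuous.
Qed.

(** Row vectors are used because [EVT_min_rV] is about them. *)
Definition sphere m : set 'rV[R]_m := [set c | dot c^T c^T = 1].

Lemma sphere_closed m : closed (@sphere m).
Proof.
rewrite [X in closed X](_ : _ = (fun c : 'rV[R]_m => dot c^T (1%:M *m c^T)) @^-1` [set 1]).
  apply: closed_comp; first by move=> c _; exact: quad_continuous.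
  exact: closed_eq.
by apply/seteqP; split=> c /=; rewrite mul1mx.
Qed.

Lemma sphere_compact m : compact (@sphere m).
Proof.
apply: bounded_closed_compact; last exact: sphere_closed.
exists 1; split; first exact: num_real.
move=> b b1 c /= c1; apply: (@le_trans _ _ 1); last exact: ltW.
rewrite /Num.Def.normr/= mx_normrE bigmax_le// => -[i j] _ /=.
have -> : c i j = c^T j 0 by rewrite mxE ord1.
apply: (le_trans (entry_le_enorm (c^T) j)).
by rewrite enorm_dot c1 sqrtr1.
Qed.

Lemma quad_min m (B : 'M[R]_m) : (0 < m)%N -> exists2 a : 'cV[R]_m,
  dot a a = 1 & forall v, dot a (B *m a) * dot v v <= dot v (B *m v).
Proof.
move=> m0.
have S0 : @sphere m !=set0.
  exists (delta_mx 0 (Ordinal m0)).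
  by rewrite /sphere/= trmx_delta dot_delta mxE !eqxx.
have [|a] := @EVT_min_rV R m (fun c => dot c^T (B *m c^T)) _ S0 (@sphere_compact m).
  by apply: continuous_subspaceT; exact: quad_continuous.
rewrite inE => a1 amin; exists a^T => // v.
have [->|v0] := eqVneq v 0; first by rewrite !dot0l mulr0.
have vv := dot_gt0 v0; have nv : enorm v ^+ 2 = dot v v := enorm_sqr v.
have ev : enorm v != 0 by rewrite -sqrf_eq0 nv gt_eqF.
have := amin ((enorm v)^-1 *: v)^T.
rewrite inE /sphere/= trmxK -scalemxAr !dotZl !dotZr -nv => h.
rewrite -ler_pdivlMr ?nv//; move: h; rewrite -nv.
have -> : (enorm v)^-1 * ((enorm v)^-1 * enorm v ^+ 2) = 1 by field.
move=> /(_ erefl) h; apply: (le_trans h).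
rewrite le_eqVlt; apply/orP; left; apply/eqP; by field.
Qed.

(** A single cluster point serves all B and N at once: each inequality cuts out a closed set
    containing a tail of the sequence. *)
Lemma sphere_cluster m (c : nat -> 'cV[R]_m) : (forall k, dot (c k) (c k) = 1) ->
  exists2 a, dot a a = 1 & forall B N,
    (forall k, (N <= k)%N -> 0 <= dot (c k) (B *m c k)) -> 0 <= dot a (B *m a).
Proof.
move=> c1.
have [|a [a1 ca]] := @sphere_compact m ((fun k => (c k)^T) @ \oo) _.
  by exists 0 => // k _; rewrite /sphere/= trmxK.
exists a^T => // B N cB.
pose Z := [set v : 'rV[R]_m | 0 <= dot v^T (B *m v^T)].
have Zclosed : closed Z.
  apply: (@closed_comp _ _ (fun v : 'rV[R]_m => dot v^T (B *m v^T)) [set x | 0 <= x]).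
    by move=> v _; exact: quad_continuous.
  exact: closed_ge.
apply: Zclosed => V Va; apply: ca => //.
exists N => // k /= Nk; rewrite /Z/= trmxK; exact: cB.
Qed.

Lemma neg_definite_coercive m (A : 'M[R]_m) : (0 < m)%N -> neg_definite A ->
  exists c e : R, [/\ 0 < c, 0 < e & forall B, opnorm (B - A) <= e ->
    forall u, c * dot u u <= - dot u (B *m u)].
Proof.
move=> m0 Aneg; have [a a1 amin] := quad_min (- A) m0.
pose c := dot a (- A *m a).
have c0 : 0 < c.
  rewrite /c mulNmx dotNr oppr_gt0 /dot mulmxA; apply: Aneg.
  by apply/eqP => a0; move: a1; rewrite a0 dot0l => /eqP; rewrite eq_sym oner_eq0.
(* Half of the coercivity constant of - A is spent on the perturbation B - A, the other half
   remains. *)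
exists (c / 2), (c / 2); split; rewrite ?divr_gt0// => B BA u.
have -> : - dot u (B *m u) = dot u (- A *m u) - dot u ((B - A) *m u).
  by rewrite mulmxBl mulNmx dotDr !dotNr; ring.
have := amin u; rewrite -/c.
suff : dot u ((B - A) *m u) <= c / 2 * dot u u by lra.
apply: (le_trans (ler_norm _)); apply: (le_trans (dot_cauchy _ _)).
rewrite -enorm_sqr expr2 mulrCA ler_wpM2l ?enorm_ge0//.
by apply: (le_trans (opnorm_bound _ _)); rewrite ler_wpM2r ?enorm_ge0.
Qed.

Lemma psd_kernel m (B : 'M[R]_m) a : B^T = B -> (forall v, 0 <= dot v (B *m v)) ->
  dot a (B *m a) = 0 -> B *m a = 0.
Proof.
move=> Bsym Bpos Ba; apply: dot_eq0; set h := B *m a.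
apply/eqP; rewrite eq_le dot_ge0 andbT leNgt; apply/negP => h0.
(* t |-> Q(a - t h) is nonnegative, vanishes at 0 and has slope -2 |h|^2. *)
pose q := dot h (B *m h).
have q0 : 0 <= q := Bpos h.
pose t := dot h h / (q + 1).
have t0 : 0 < t by rewrite divr_gt0// ltr_wpDl.
have := Bpos (a - t *: h).
rewrite mulmxBr dotDl !dotDr !(dotNl, dotNr) -scalemxAr !(dotZl, dotZr) Ba -/h -/q.
have -> : dot a (B *m h) = dot h h by rewrite dotC dot_mulmxl Bsym.
have tq : t * q < dot h h.
  rewrite /t mulrAC ltr_pdivrMr ?ltr_wpDl//; rewrite mulrDr mulr1.
  by rewrite ltrDl.
suff : t * (t * q) < t * dot h h by have := mulr_gt0 t0 h0; lra.
by rewrite ltr_pM2l.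
Qed.

(** The minimum of the Rayleigh quotient of the Gram matrix is its least eigenvalue; injectivity of
    A makes it positive. *)
Lemma min_spectrum_gram m p (A : 'M[R]_(m, p)) : (0 < p)%N ->
  (forall a : 'cV[R]_p, A *m a = 0 -> a = 0) ->
  0 < min_spectrum (A^T *m A) /\
  forall a, Num.sqrt (min_spectrum (A^T *m A)) * enorm a <= enorm (A *m a).
Proof.
move=> p0 Ainj; set S := A^T *m A.
have SE a : dot a (S *m a) = dot (A *m a) (A *m a) by rewrite dot_mulmxl mulmxA.
have Ssym : S^T = S by rewrite /S trmx_mul trmxK.
have [a a1 amin] := quad_min S p0; set mu := dot a (S *m a) in amin.
(* Since mu is the minimum, S - mu is positive semidefinite and its form vanishes at a, so
   [psd_kernel] makes a an eigenvector. *)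
have Sa : S *m a = mu *: a.
  apply/eqP; rewrite -subr_eq0 -mul_scalar_mx -mulmxBl; apply/eqP.
  apply: psd_kernel.
  - by rewrite linearB/= Ssym tr_scalar_mx.
  - by move=> v; rewrite mulmxBl mul_scalar_mx dotDr dotNr dotZr subr_ge0.
  - by rewrite mulmxBl mul_scalar_mx dotDr dotNr dotZr a1 mulr1 subrr.
have a_neq0 : a != 0.
  by apply/eqP => a0; move: a1; rewrite a0 dot0l => /eqP; rewrite eq_sym oner_eq0.
(* Eigenvectors in [eigenvalue] are rows, hence the transposes and the symmetry of S. The value mu
   gives both the nonemptiness and the lower bound that make the infimum meaningful. *)
have muE : min_spectrum S = mu.
  apply/eqP; rewrite eq_le; apply/andP; split.
    apply: ge_inf.
      exists mu => b /eigenvalueP[v vS v0].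
      have vT0 : v^T != 0 by rewrite trmx_eq0.
      have := amin v^T.
      have -> : S *m v^T = b *: v^T by rewrite -[S]Ssym -trmx_mul vS linearZ.
      by rewrite dotZr ler_pM2r// dot_gt0.
    apply/eigenvalueP; exists a^T; last by rewrite trmx_eq0.
    by rewrite -[S]Ssym -trmx_mul Sa linearZ.
  apply: lb_le_inf.
    exists mu; apply/eigenvalueP; exists a^T; last by rewrite trmx_eq0.
    by rewrite -[S]Ssym -trmx_mul Sa linearZ.
  move=> b /eigenvalueP[v vS v0].
  have vT0 : v^T != 0 by rewrite trmx_eq0.
  have := amin v^T.
  have -> : S *m v^T = b *: v^T by rewrite -[S]Ssym -trmx_mul vS linearZ.
  by rewrite dotZr ler_pM2r// dot_gt0.
rewrite muE; split.
  rewrite /mu SE dot_gt0//; apply: contra_neq a_neq0; exact: Ainj.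
move=> v; rewrite !enorm_dot -sqrtrM; last by rewrite /mu SE dot_ge0.
by rewrite ler_wsqrtr// -SE.
Qed.

End quadratic_forms.

(** * Flux and decay at minus infinity *)

Section hyperbolic.
Variables (R : realType) (n : nat) (d : 'rV[R]_n) (M : R -> 'M[R]_n).
Variables (k c x1 : R).
Hypothesis sys_bound : forall x (v : 'cV[R]_(n + n)),
  enorm (sysmx d (M x) *m v) <= k * enorm v.
Hypothesis c_gt0 : 0 < c.
Hypothesis coerciveD : forall w : 'cV[R]_n,
  c * dot w w <= dot w (invmx (diag_mx d) *m w).
Hypothesis coerciveM : forall x, x <= x1 -> forall u : 'cV[R]_n,
  c * dot u u <= - dot u (M x *m u).

(** With w = D u' this is u . D u'. Along a solution its derivative is w . D^-1 w - u . M u, which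
    is coercive for x <= x1. *)
Definition flux (U : 'cV[R]_(n + n)) : R := dot (usubmx U) (dsubmx U).

Let dflux (x : R) (U : 'cV[R]_(n + n)) : R :=
  dot (dsubmx U) (invmx (diag_mx d) *m dsubmx U) - dot (usubmx U) (M x *m usubmx U).

Lemma is_derive_flux U (x : R) : is_solution d M U ->
  is_derive x 1 (fun t => flux (U t)) (dflux x (U x)).
Proof.
move=> /is_solutionP/(_ x)[u w].
rewrite /dflux dotC -dotNr -mulNmx; exact: is_derive_dot.
Qed.

Lemma dflux_ge x U : x <= x1 -> c * dot U U <= dflux x U.
Proof.
move=> xx1; rewrite dot_vsubmx mulrDr addrC lerD//; last exact: coerciveM.
Qed.

Lemma flux_nondecreasing U x y : is_solution d M U -> x <= y -> y <= x1 ->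
  flux (U x) <= flux (U y).
Proof.
move=> Us xy yx1.
apply: (is_derive_nondecreasing xy (fun t _ => is_derive_flux t Us)).
move=> t /andP[_ ty]; apply: le_trans (dflux_ge _ (le_trans ty yx1)).
by rewrite mulr_ge0 ?dot_ge0// ltW.
Qed.

Lemma flux_le (U : 'cV[R]_(n + n)) : 2 * flux U <= dot U U.
Proof.
rewrite dot_vsubmx /flux; have := dot_ge0 (usubmx U - dsubmx U).
by rewrite dotDl !dotDr !(dotNl, dotNr) (dotC (dsubmx U) (usubmx U)); lra.
Qed.

(* flux' >= 2 c flux makes the nonnegative flux decay like e^(2cx), and
   |U(x)|^2 is comparable to the increment of the flux over [x - 1, x]. *)
Lemma flux_ge0_decay U : is_solution d M U -> (forall x, x <= x1 -> 0 <= flux (U x)) ->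
  exists C : R, forall x, x <= x1 -> dot (U x) (U x) <= C * expR (2 * c * x).
Proof.
move=> Us U0.
(* A negative k would force U = 0; otherwise k >= 0 allows the Gronwall exponent below to be bounded
   by 2k. *)
have k0 : 0 <= k \/ forall x, U x = 0.
  have [k0|k0] := leP 0 k; [by left|right=> x].
  apply: enorm_eq0; apply/eqP; rewrite eq_le enorm_ge0 andbT.
  have := le_trans (enorm_ge0 _) (sys_bound x (U x)).
  by rewrite nmulr_rge0.
case: k0 => [k0|U00]; last first.
  by exists 0 => x _; rewrite U00 dot0l mul0r.
have q_decay x : x <= x1 ->
    flux (U x) <= flux (U x1) * expR (- 2 * c * x1) * expR (2 * c * x).
  move=> xx1.
  suff h : flux (U x) * expR (- 2 * c * x) <= flux (U x1) * expR (- 2 * c * x1).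
    rewrite -(ler_pM2r (expR_gt0 (- 2 * c * x))) -[leRHS]mulrA -expRD.
    by rewrite (_ : 2 * c * x + _ = 0) ?expR0 ?mulr1//; ring.
  apply: (is_derive_nondecreasing xx1 (fun t _ => is_derive_mul
    (is_derive_flux t Us) (is_derive_expRM (- 2 * c) t))).
  move=> t /andP[_ tx1].
  rewrite mulrA -mulrDl mulr_ge0 ?expR_ge0//.
  have := dflux_ge (U t) tx1; have := flux_le (U t).
  rewrite -(ler_pM2l c_gt0); lra.
exists (expR (2 * k) / c * (flux (U x1) * expR (- 2 * c * x1))) => x xx1.
have x1x : x - 1 <= x by lra.
have [y /andP[xy yx] qE] := is_derive_MVT x1x (fun t _ => is_derive_flux t Us).
(* Here y is the mean value point of the flux in [x - 1, x]; passing from x to y, a distance of at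
   most 1, costs the factor e^(2k). *)
have [+ _] := solution_growth sys_bound Us yx => gxy.
have {}gxy : dot (U x) (U x) <= expR (2 * k) * dot (U y) (U y).
  rewrite -(ler_pM2r (expR_gt0 (- 2 * k * x))) (le_trans gxy)//.
  rewrite (mulrC (expR (2 * k))) -[leRHS]mulrA ler_wpM2l ?dot_ge0// -expRD ler_expR.
  have : k * (x - y) <= k * 1 by rewrite ler_wpM2l// lerBlDl; lra.
  lra.
apply: (le_trans gxy); rewrite -!mulrA ler_pM2l ?expR_gt0//.
rewrite mulrC ler_pdivlMr// mulrC !mulrA.
have yx1 := le_trans yx xx1.
apply: (le_trans (dflux_ge (U y) yx1)).
have -> : dflux y (U y) = flux (U x) - flux (U (x - 1)).
  by rewrite qE; ring.
rewrite lerBlDr (le_trans (q_decay x xx1))// lerDl U0//.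
by rewrite (le_trans x1x).
Qed.

(* Unit vectors v_N with E^T v_N = 0 and first component of F v_N vanishing at
   x1 - N exist for dimension reasons; their cluster point is the witness. *)
Lemma lower_rank_solution (m : nat) (F : R -> 'M[R]_(n + n)) (E : 'M[R]_(n + n, m)) :
  (forall v, is_solution d M (fun x => F x *m v)) -> (\rank E < n)%N ->
  exists2 v, E^T *m v = 0 /\ v != 0 & forall x, x <= x1 -> 0 <= flux (F x *m v).
Proof.
move=> Fs rE.
have cN (N : nat) : exists v : 'cV[R]_(n + n), [/\ dot v v = 1, E^T *m v = 0 &
    usubmx (F (x1 - N%:R) *m v) = 0].
  set A := usubmx (F (x1 - N%:R)).
  (* Fewer than n conditions from E and n from the first component: together fewer than 2n, so a
     nonzero vector satisfies all of them. *)
  have : ~~ row_free (row_mx E A^T).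
    rewrite /row_free neq_ltn; apply/orP; left.
    rewrite -mxrank_tr tr_row_mx trmxK -addsmxE.
    apply: (leq_ltn_trans (mxrank_adds_leqif _ _)).
    by rewrite mxrank_tr -addSn leq_add// rank_leq_row.
  rewrite -kermx_eq0 => /rowV0Pn[v /sub_kermxP vE v0].
  have vT0 : v^T != 0 by rewrite trmx_eq0.
  have /dot_gt0 vv := vT0.
  have ev : enorm v^T != 0 by rewrite -sqrf_eq0 enorm_sqr gt_eqF.
  exists ((enorm v^T)^-1 *: v^T); split.
  - by rewrite dotZl dotZr -enorm_sqr; field.
  - move: vE; rewrite mul_mx_row => /eqP; rewrite row_mx_eq0 => /andP[/eqP vE _].
    by rewrite -scalemxAr -trmx_mul vE trmx0 scaler0.
  - move: vE; rewrite mul_mx_row => /eqP; rewrite row_mx_eq0 => /andP[_ /eqP vA].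
    by rewrite -mul_usub_mx -/A -scalemxAr -[A]trmxK -trmx_mul vA trmx0 scaler0.
have [v vP] := choice cN.
have [|a a1 aP] := @sphere_cluster R _ v; first by move=> N; have [] := vP N.
exists a.
  split; last by apply/eqP => a0; move: a1; rewrite a0 dot0l => /eqP; rewrite eq_sym oner_eq0.
  (* The condition E^T a = 0 is passed to the limit as the quadratic inequality 0 <= - |E^T v|^2,
     which [sphere_cluster] can handle. *)
  apply: dot_eq0; apply/eqP; rewrite eq_le dot_ge0 andbT.
  rewrite -oppr_ge0 dot_mulmxl trmxK mulmxA -dotNr -mulNmx.
  apply: (aP _ 0) => N _; have [_ Ev _] := vP N.
  by rewrite mulNmx -mulmxA Ev mulmx0 oppr0 dot0r.
move=> x xx1.
pose Q : 'M[R]_(n + n) := block_mx 0 1%:M 0 0.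
have QE (U : 'cV[R]_(n + n)) : flux U = dot U (Q *m U).
  rewrite -{3}(vsubmxK U) /Q mul_block_col !mul0mx !add0r mul1mx.
  by rewrite dot_vsubmx col_mxKu col_mxKd dot0r addr0.
have QFE w : flux (F x *m w) = dot w ((F x)^T *m Q *m F x *m w).
  by rewrite QE dot_mulmxl !mulmxA.
have [N xN] : exists N : nat, x1 - N%:R <= x.
  exists (Num.truncn (x1 - x)).+1; rewrite lerBlDr -lerBlDl ltW// truncnS_gt//.
rewrite QFE; apply: (aP _ N) => j Nj; rewrite -QFE.
have [_ _ vj0] := vP j.
(* The flux of v_j is 0 at x1 - j, which is left of x for j >= N, and it does not decrease up to
   x1. *)
apply: (@le_trans _ _ (flux (F (x1 - j%:R) *m v j))).
  by rewrite {1}/flux vj0 dot0l.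
apply: (flux_nondecreasing (Fs (v j))) => //.
by rewrite (le_trans _ xN)// lerB// ler_nat.
Qed.

End hyperbolic.

(** * Square integrability and weak derivatives *)

Section square_integrable.
Variable R : realType.
Local Notation mu := (@lebesgue_measure R).

Lemma continuous_expRMabs (a : R) : continuous (fun x : R => expR (- a * `|x|)).
Proof.
move=> x; apply: continuous_comp; last exact: continuous_expR.
by apply: continuousM; [exact: cst_continuous|exact: norm_continuous].
Qed.

Lemma integral_expRMabs (a : R) : 0 < a ->
  (\int[mu]_x (expR (- a * `|x|))%:E < +oo)%E.
Proof.
move=> a0; rewrite ge0_symfun_integralT.
- rewrite -set_itvcy.
  have -> : (\int[mu]_(x in `[0%R, +oo[) (expR (- a * `|x|))%:E =
      \int[mu]_(x in `[0%R, +oo[) (expR (- a * x))%:E)%E.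
    apply: eq_integral => x; rewrite inE/= in_itv/= andbT => x0.
    by rewrite ger0_norm.
  have Fd (x : R) : is_derive x 1 (fun t => - a^-1 * expR (- a * t)) (expR (- a * x)).
    rewrite [X in is_derive _ _ _ X](_ : _ = 0 * expR (- a * x) +
        - a^-1 * (- a * expR (- a * x))).
      exact: (is_derive_mul (is_derive_cst _ _ _) (is_derive_expRM _ _)).
    by field; rewrite gt_eqF.
  rewrite (@ge0_continuous_FTC2y R _ (fun t => - a^-1 * expR (- a * t)) 0 0).
  + by rewrite -EFinB -EFinM ltry.
  + by move=> x _; exact: expR_ge0.
  + apply: continuous_subspaceT => x.
    exact: is_derive_continuous (is_derive_expRM _ _).
  + rewrite -[X in _ --> X](mulr0 (- a^-1)).
    apply: cvgM; first exact: cvg_cst.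
    have -> : (fun t : R => expR (- a * t)) = (fun t => expR (- t)) \o (fun t => a * t).
      by apply/funext => t /=; rewrite mulNr.
    apply: cvg_comp; last exact: cvgr_expR.
    exact: gt0_cvgMry.
  + by move=> x _; have [] := Fd x.
  + apply: cvg_at_right_filter; exact: is_derive_continuous (Fd 0).
  + by move=> x _; have [_] := Fd x; rewrite derive1E.
- by move=> x; exact: expR_ge0.
- exact: continuous_expRMabs.
- by move=> x /=; rewrite normrN.
Qed.

Lemma expRMabs_Lfun2 (f : R -> R) (C a : R) : 0 < a -> continuous f ->
  (forall x, f x ^+ 2 <= C * expR (- a * `|x|)) -> f \in Lfun mu 2%:E.
Proof.
move=> a0 fc fC.
have mf : measurable_fun [set: R] f by exact: continuous_measurable_fun.
rewrite inE; apply/andP; split; first by rewrite inE.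
rewrite inE/= /finite_norm unlock /Lnorm.
apply: poweR_lty.
have -> : (\int[mu]_x `|(EFin \o f) x| `^ 2 = \int[mu]_x (f x ^+ 2)%:E)%E.
  by apply: eq_integral => x _; rewrite /= powR_mulrn// real_normK ?num_real.
have C0 : 0 <= C.
  have := le_trans (sqr_ge0 _) (fC 0).
  by rewrite normr0 mulr0 expR0 mulr1.
apply: (@le_lt_trans _ _ (\int[mu]_x (C * expR (- a * `|x|))%R%:E)%E).
  apply: ge0_le_integral => //.
  - by move=> x _; rewrite lee_fin sqr_ge0.
  - by apply/measurable_EFinP; exact: measurable_funX.
  - apply/measurable_EFinP; apply: continuous_measurable_fun => x.
    by apply: cvgM; [exact: cvg_cst|exact: continuous_expRMabs].
  - by move=> x _; rewrite lee_fin.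
under eq_integral do rewrite EFinM.
rewrite ge0_integralZl//.
- exact: lte_mul_pinfty (integral_expRMabs a0).
- apply/measurable_EFinP; apply: continuous_measurable_fun.
  exact: continuous_expRMabs.
Qed.

Lemma is_derive_weak_derivative (f g : R -> R) :
  (forall x : R, is_derive x 1 f (g x)) -> continuous g -> weak_derivative f g.
Proof.
move=> fd gc psi [psid [a psi0]].
(* The radius a may be negative; |a| + 1 is positive and beyond it, so psi vanishes at both ends and
   integration by parts on [-b, b] has no boundary terms. *)
pose b := `|a| + 1.
have ab : a < b by rewrite /b (le_lt_trans (ler_norm a))// ltrDl.
have b0 : 0 < b by rewrite /b ltr_wpDl.
have psi1 (x : R) : derivable psi x 1 by exact: (psid 0).
have psi2 (x : R) : derivable (derive1 psi) x 1 by exact: (psid 1).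
have cont h : (forall x : R, derivable h x 1) -> continuous (h : R -> R).
  by move=> hd x; exact/differentiable_continuous/derivable1_diffP.
have fc : continuous f by apply: cont => x; have [] := fd x.
have dpsi0 x : a < `|x| -> derive1 psi x = 0.
  move=> ax; rewrite derive1E.
  have : \forall y \near x, psi y = cst 0 y.
    near=> y; apply: psi0; near: y.
    by apply: (cvgr_gt `|x|) => //; exact: norm_continuous.
  by move=> /near_eq_derive ->; exact: derive_cst.
have restr (h : R -> R) : (forall x, a < `|x| -> h x = 0) ->
    \int[mu]_x h x = \int[mu]_(x in `[- b, b]) h x.
  move=> h0; rewrite Rintegral_mkcond [RHS]Rintegral_mkcond.
  congr (Rintegral _ _ _); apply/funext => x; rewrite !patchE in_setT.
  case: ifPn => // /negP xb; apply: h0; rewrite ltNge; apply/negP => xa.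
  apply: xb; rewrite inE/= in_itv/= -ler_norml; exact: le_trans (ltW ab).
rewrite (restr (fun x => f x * derive1 psi x)); last first.
  by move=> x ax; rewrite dpsi0// mulr0.
rewrite (restr (fun x => g x * psi x)); last first.
  by move=> x ax; rewrite psi0// mulr0.
have bb : - b < b by lra.
have psib x : `|x| = b -> psi x = 0 by move=> xb; apply: psi0; rewrite xb.
have LR (h : R -> R) : (forall x : R, derivable h x 1) -> derivable_oo_LRcontinuous h (- b) b.
  move=> hd; split; first by move=> x _; exact: hd.
  - by apply: cvg_at_right_filter; exact: cont.
  - by apply: cvg_at_left_filter; exact: cont.
apply: etrans (@Rintegration_by_parts R f psi g (derive1 psi) (- b) b bb _ _ _ _ _ _) _.
- exact: continuous_subspaceT.
- by apply: LR => x; have [] := fd x.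
- by move=> x _; rewrite derive1E; have [_] := fd x.
- by apply: continuous_subspaceT; exact: cont.
- exact: LR.
- by [].
- rewrite (psib b) ?ger0_norm ?(ltW b0)// (psib (- b)); last first.
    by rewrite normrN ger0_norm ?(ltW b0).
  by rewrite !mulr0 subrr sub0r.
Unshelve. all: by end_near. Qed.

End square_integrable.

(** * The asymptotic basis *)

Section asymptotic_basis.
Variables (R : realType) (n : nat) (hn : (1 < n)%N) (d : 'rV[R]_n).
Hypothesis d_gt0 : forall j, 0 < d 0 j.
Variables (z : 'I_n -> 'cV[R]_n) (nu : 'I_n -> R).
Hypothesis z_orth : forall i j, (z i)^T *m z j = (i == j)%:R%:M.
Hypothesis nu_ord : forall i j : 'I_n, (i < j)%N -> nu j < nu i.
Hypothesis nu_gt0 : forall j, 0 < nu j.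

Implicit Types b p q y : 'cV[R]_n.

Let nu1 := nu (ord_first hn).
Let nun := nu (ord_last hn).
Let nu1_gt0 : 0 < nu1. Proof. exact: nu_gt0. Qed.
Let nun_gt0 : 0 < nun. Proof. exact: nu_gt0. Qed.

Lemma nu_le_first j : nu j <= nu1.
Proof.
have [j0|j0] := eqVneq j (ord_first hn); first by rewrite j0.
by rewrite ltW// nu_ord//= lt0n; apply: contra_neq j0 => j0; apply/val_inj.
Qed.

Lemma nu_last_le j : nun <= nu j.
Proof.
have [j0|j0] := eqVneq j (ord_last hn); first by rewrite j0.
rewrite ltW// nu_ord//= ltn_neqAle -ltnS prednK ?ltn_ord ?(ltnW hn)// andbT.
by apply: contra_neq j0 => j0; apply/val_inj.
Qed.

Lemma row_max_ge j : d 0 j <= row_max d.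
Proof. exact: le_bigmax. Qed.

Lemma row_max_gt0 : 0 < row_max d.
Proof. exact: lt_le_trans (d_gt0 (ord_first hn)) (row_max_ge _). Qed.

Lemma row_min_le j : row_min d <= d 0 j.
Proof. exact: bigmin_le. Qed.

Lemma row_min_gt0 : 0 < row_min d.
Proof. by apply/bigmin_gtP; split=> [|j _]; [exact: row_max_gt0|exact: d_gt0]. Qed.

Lemma dot_orth (c c' : 'I_n -> R) :
  dot (\sum_i c i *: z i) (\sum_i c' i *: z i) = \sum_i c i * c' i.
Proof.
have zz i j : dot (z i) (z j) = (i == j)%:R by rewrite /dot z_orth mxE eqxx mulr1n.
rewrite dot_sumr; apply: eq_bigr => i _.
rewrite dotZr dotC dot_sumr (bigD1 i)//= big1 ?addr0.
  by rewrite dotZr zz eqxx mulr1 mulrC.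
by move=> j ji; rewrite dotZr zz eq_sym (negbTE ji) mulr0.
Qed.

Lemma dot_diag (e : 'rV[R]_n) y :
  dot (diag_mx e *m y) (diag_mx e *m y) = \sum_j e 0 j ^+ 2 * y j 0 ^+ 2.
Proof. by rewrite dotE; apply: eq_bigr => j _; rewrite mul_diag_mx mxE; ring. Qed.

Lemma sqrtD_gt0 j : 0 < map_mx Num.sqrt d 0 j.
Proof. by rewrite mxE sqrtr_gt0. Qed.

Lemma sqrtD_dot (u w : 'cV[R]_n) :
  dot (invmx (sqrtD d) *m u) (sqrtD d *m w) = dot u w.
Proof.
rewrite invmx_diag; last exact: sqrtD_gt0.
rewrite !dotE; apply: eq_bigr => j _; rewrite !mul_diag_mx !mxE.
by rewrite mulrACA mulVf ?mul1r// gt_eqF// sqrtr_gt0.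
Qed.

Lemma enorm_sqrtD_le y : enorm (sqrtD d *m y) <= Num.sqrt (row_max d) * enorm y.
Proof.
rewrite !enorm_dot -sqrtrM ?(ltW row_max_gt0)//; apply: ler_wsqrtr.
rewrite dot_diag dotE mulr_sumr; apply: ler_sum => j _.
by rewrite -expr2 ler_wpM2r ?sqr_ge0// mxE sqr_sqrtr ?row_max_ge// ltW.
Qed.

Lemma enorm_invsqrtD_le y :
  enorm (invmx (sqrtD d) *m y) <= Num.sqrt (row_min d)^-1 * enorm y.
Proof.
rewrite !enorm_dot -sqrtrM ?invr_ge0 ?(ltW row_min_gt0)//; apply: ler_wsqrtr.
rewrite invmx_diag; last exact: sqrtD_gt0.
rewrite dot_diag dotE mulr_sumr; apply: ler_sum => j _.
rewrite -expr2 ler_wpM2r ?sqr_ge0// !mxE exprVn sqr_sqrtr ?(ltW (d_gt0 _))//.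
by rewrite lef_pV2 ?posrE ?row_min_gt0// row_min_le.
Qed.

Lemma enorm_invsqrtD_ge y :
  enorm y <= Num.sqrt (row_max d) * enorm (invmx (sqrtD d) *m y).
Proof.
rewrite -{1}[y](mulKVmx (diag_mx_unit sqrtD_gt0)); exact: enorm_sqrtD_le.
Qed.

(** Up to D^(-1/2), the first component shared by the combinations of the [Vu] and of the [Vs] with
    coefficients p. *)
Definition profile (p : 'cV[R]_n) : 'cV[R]_n :=
  \sum_j ((Num.sqrt (2 * nu j))^-1 * p j 0) *: z j.

(** The second component of the same combinations, up to D^(1/2) and, for the [Vs], up to sign; the
    weight nu_j is the rate of the exponential. *)
Definition profile' (p : 'cV[R]_n) : 'cV[R]_n :=
  \sum_j ((Num.sqrt (2 * nu j))^-1 * nu j * p j 0) *: z j.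

Lemma sum_col_mx m (u w : 'I_m -> 'cV[R]_n) :
  \sum_j col_mx (u j) (w j) = col_mx (\sum_j u j) (\sum_j w j).
Proof.
elim/big_ind3 : _ => // [|u1 u2 u3 w1 w2 w3 -> ->]; first by rewrite col_mx0.
by rewrite add_col_mx.
Qed.

Lemma Vu_sum p : \sum_j p j 0 *: Vu d (nu j) (z j) =
  col_mx (invmx (sqrtD d) *m profile p) (sqrtD d *m profile' p).
Proof.
rewrite /profile /profile' !mulmx_sumr -sum_col_mx; apply: eq_bigr => j _.
rewrite /Vu -!scalemxAr scalerA !scale_col_mx !scalerA.
by congr (col_mx (_ *: _) (_ *: _)); ring.
Qed.

Lemma Vs_sum p : \sum_j p j 0 *: Vs d (nu j) (z j) =
  col_mx (invmx (sqrtD d) *m profile p) (- (sqrtD d *m profile' p)).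
Proof.
rewrite /profile /profile' !mulmx_sumr -sumrN -sum_col_mx; apply: eq_bigr => j _.
rewrite /Vs -!scalemxAr scalerA !scale_col_mx !scalerA -scaleNr.
by congr (col_mx (_ *: _) (_ *: _)); ring.
Qed.

Lemma sqrt2nu_sqr j : (Num.sqrt (2 * nu j))^-1 ^+ 2 = (2 * nu j)^-1.
Proof. by rewrite exprVn sqr_sqrtr// mulr_ge0// ltW. Qed.

(** This is where the normalisation by sqrt(2 nu_j) pays off: the weights cancel and the symplectic
    pairing becomes the plain scalar product. *)
Lemma dot_profile' b p : 2 * dot (profile b) (profile' p) = dot b p.
Proof.
rewrite /profile /profile' dot_orth dotE mulr_sumr; apply: eq_bigr => j _.
have -> : 2 * ((Num.sqrt (2 * nu j))^-1 * b j 0 * ((Num.sqrt (2 * nu j))^-1 * nu j * p j 0)) =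
   (Num.sqrt (2 * nu j))^-1 ^+ 2 * (2 * nu j) * (b j 0 * p j 0) by ring.
by rewrite sqrt2nu_sqr mulVf ?mul1r// mulf_neq0// gt_eqF.
Qed.

Lemma enorm_profile_le p : enorm (profile p) <= Num.sqrt (2 * nun)^-1 * enorm p.
Proof.
rewrite !enorm_dot -sqrtrM ?invr_ge0 ?mulr_ge0 ?(ltW (nu_gt0 _))//.
apply: ler_wsqrtr; rewrite dot_orth dotE mulr_sumr; apply: ler_sum => j _.
rewrite -!expr2 exprMn sqrt2nu_sqr ler_wpM2r ?sqr_ge0//.
by rewrite lef_pV2 ?posrE ?mulr_gt0// ler_pM2l// nu_last_le.
Qed.

Lemma enorm_profile_ge p : enorm p <= Num.sqrt (2 * nu1) * enorm (profile p).
Proof.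
rewrite !enorm_dot -sqrtrM ?mulr_ge0 ?(ltW (nu_gt0 _))//.
apply: ler_wsqrtr; rewrite dot_orth dotE mulr_sumr; apply: ler_sum => j _.
rewrite -!expr2 exprMn sqrt2nu_sqr mulrA -[leLHS]mul1r ler_wpM2r ?sqr_ge0//.
by rewrite ler_pdivlMr ?mulr_gt0// mul1r ler_pM2l// nu_le_first.
Qed.

Lemma enorm_profile'_le p : enorm (profile' p) <= Num.sqrt (nu1 / 2) * enorm p.
Proof.
rewrite !enorm_dot -sqrtrM ?divr_ge0 ?(ltW (nu_gt0 _))//.
apply: ler_wsqrtr; rewrite dot_orth dotE mulr_sumr; apply: ler_sum => j _.
rewrite -!expr2 !exprMn sqrt2nu_sqr ler_wpM2r ?sqr_ge0//.
have -> : (2 * nu j)^-1 * nu j ^+ 2 = nu j / 2 by field; rewrite gt_eqF.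
by rewrite ler_pM2r ?invr_gt0// nu_le_first.
Qed.

Lemma omega_Vs_Vu b p :
  omega (\sum_j b j 0 *: Vs d (nu j) (z j)) (\sum_j p j 0 *: Vu d (nu j) (z j)) = dot b p.
Proof.
rewrite Vs_sum Vu_sum /omega !col_mxKu !col_mxKd dotNl opprK.
rewrite sqrtD_dot [X in _ + X]dotC sqrtD_dot.
have -> : dot (profile p) (profile' b) = dot (profile b) (profile' p).
  apply: (@mulfI _ 2); first by rewrite pnatr_eq0.
  by rewrite !dot_profile' dotC.
by rewrite -(dot_profile' b p) mulr2n mulrDl mul1r.
Qed.

Let C1 := Num.sqrt (2 * n%:R / (nun * row_min d)) +
          Num.sqrt (2 * n%:R * nu1 * row_max d).

(** The sign e is 1 for the unstable and -1 for the stable vectors. The factor sqrt n is carried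
    along because in the pairing these sums meet sums of the W_j, whose bound contains it. *)
Lemma enorm_V_le (e : R) p : `|e| = 1 -> Num.sqrt n%:R *
  enorm (col_mx (invmx (sqrtD d) *m profile p) (e *: (sqrtD d *m profile' p)))
   <= C1 / 2 * enorm p.
Proof.
move=> e1.
have nun0 : 0 < nun := nu_gt0 _.
have nu10 : 0 < nu1 := nu_gt0 _.
have dmin0 := row_min_gt0; have dmax0 := row_max_gt0.
have n0 : 0 <= n%:R :> R := ler0n _ _.
apply: (@le_trans _ _ (Num.sqrt n%:R * ((Num.sqrt (row_min d)^-1 * Num.sqrt (2 * nun)^-1 +
   Num.sqrt (row_max d) * Num.sqrt (nu1 / 2)) * enorm p))).
  rewrite ler_wpM2l ?sqrtr_ge0// (le_trans (enorm_col_mx _ _))// mulrDl lerD//.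
    rewrite (le_trans (enorm_invsqrtD_le _))// -mulrA ler_wpM2l ?sqrtr_ge0//.
    exact: enorm_profile_le.
  rewrite enormZ e1 mul1r.
  rewrite (le_trans (enorm_sqrtD_le _))// -mulrA ler_wpM2l ?sqrtr_ge0//.
  exact: enorm_profile'_le.
(* Brings sqrt(n / (2 nu d)) and sqrt(n nu d / 2) to the shape of the roots in C_Q, each with a
   factor 1/2. *)
have h4 (t : R) : 0 <= t -> Num.sqrt t = Num.sqrt (4 * t) / 2.
  move=> t0; rewrite sqrtrM// (_ : 4 = 2 ^+ 2); last by ring.
  by rewrite sqrtr_sqr ger0_norm// mulrAC divff ?mul1r.
have dmini0 : 0 <= (row_min d)^-1 by rewrite invr_ge0 ltW.
have nuni0 : 0 <= (2 * nun)^-1 by rewrite invr_ge0 mulr_ge0 ?ltW.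
have nu120 : 0 <= nu1 / 2 by rewrite divr_ge0 ?ltW.
have E1 : Num.sqrt n%:R * (Num.sqrt (row_min d)^-1 * Num.sqrt (2 * nun)^-1) =
    Num.sqrt (2 * n%:R / (nun * row_min d)) / 2.
  rewrite -(sqrtrM _ dmini0) -(sqrtrM _ n0) h4 ?mulr_ge0//.
  by congr (Num.sqrt _ / 2); field; rewrite !gt_eqF.
have E2 : Num.sqrt n%:R * (Num.sqrt (row_max d) * Num.sqrt (nu1 / 2)) =
    Num.sqrt (2 * n%:R * nu1 * row_max d) / 2.
  rewrite -(sqrtrM _ (ltW dmax0)) -(sqrtrM _ n0) h4 ?mulr_ge0// ?(ltW dmax0) ?(ltW nu10)//.
  by congr (Num.sqrt _ / 2); field.
by rewrite mulrA mulrDr E1 E2 /C1 -mulrDl.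
Qed.

Lemma enorm_Vu_le p :
  Num.sqrt n%:R * enorm (\sum_j p j 0 *: Vu d (nu j) (z j)) <= C1 / 2 * enorm p.
Proof.
by rewrite Vu_sum -[sqrtD d *m _]scale1r; apply: enorm_V_le; rewrite normr1.
Qed.

Lemma enorm_Vs_le p :
  Num.sqrt n%:R * enorm (\sum_j p j 0 *: Vs d (nu j) (z j)) <= C1 / 2 * enorm p.
Proof.
by rewrite Vs_sum -scaleN1r; apply: enorm_V_le; rewrite normrN1.
Qed.

(** * Pairing and Dirichlet condition in the perturbed frame *)

Section perturbation.
Variables (eps0 : R) (ws wu : 'I_n -> 'cV[R]_(n + n)).
Hypothesis eps0_ge0 : 0 <= eps0.
Hypothesis ws_le : forall j, enorm (ws j) <= eps0.
Hypothesis wu_le : forall j, enorm (wu j) <= eps0.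

Lemma enorm_W_le (w : 'I_n -> 'cV[R]_(n + n)) p : (forall j, enorm (w j) <= eps0) ->
  enorm (\sum_j p j 0 *: w j) <= eps0 * (Num.sqrt n%:R * enorm p).
Proof.
move=> w_le; apply: (le_trans (enorm_sum _)).
apply: (@le_trans _ _ (eps0 * \sum_j `|p j 0|)); last first.
  by rewrite ler_wpM2l// sum_entry_le_enorm.
by rewrite mulr_sumr; apply: ler_sum => j _; rewrite enormZ mulrC ler_wpM2r.
Qed.

Let VUx p := \sum_j p j 0 *: (Vu d (nu j) (z j) + wu j).
Let VSx p := \sum_j p j 0 *: (Vs d (nu j) (z j) + ws j).

Let C_Q := Num.sqrt (2 * n%:R / (nun * row_min d)) +
           Num.sqrt (2 * n%:R * nu1 * row_max d) + 2 * eps0 * n%:R.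

Let big_split_V (V w : 'I_n -> 'cV[R]_(n + n)) (p : 'cV[R]_n) :
  \sum_j p j 0 *: (V j + w j) = \sum_j p j 0 *: V j + \sum_j p j 0 *: w j.
Proof. by rewrite -big_split; apply: eq_bigr => j _; rewrite scalerDr. Qed.

(** The two cross terms cost eps0 C1 / 2 each and the term quadratic in the perturbations eps0^2 n;
    their sum lies below eps0 C_Q. *)
Lemma omega_perturbed b p :
  `|omega (VSx b) (VUx p) - dot b p| <= eps0 * C_Q * (enorm b * enorm p).
Proof.
rewrite /VSx /VUx !big_split_V omegaDl !omegaDr omega_Vs_Vu.
set S := \sum_j b j 0 *: Vs _ _ _; set U := \sum_j p j 0 *: Vu _ _ _.
set s := \sum_j b j 0 *: ws j; set u := \sum_j p j 0 *: wu j.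
have -> : dot b p + omega S u + (omega s U + omega s u) - dot b p =
  omega S u + omega s U + omega s u by ring.
have b0 := enorm_ge0 b; have p0 := enorm_ge0 p.
have sn : Num.sqrt n%:R ^+ 2 = n%:R :> R by rewrite sqr_sqrtr.
have hS := enorm_Vs_le b; have hU := enorm_Vu_le p.
have hs := enorm_W_le b ws_le; have hu := enorm_W_le p wu_le.
rewrite -/S in hS; rewrite -/U in hU; rewrite -/s in hs; rewrite -/u in hu.
have h1 : `|omega S u| <= eps0 * (C1 / 2) * (enorm b * enorm p).
  apply: (le_trans (omega_le _ _)).
  apply: (le_trans (ler_wpM2l (enorm_ge0 _) hu)).
  have := ler_wpM2r (mulr_ge0 eps0_ge0 p0) hS; lra.
have h2 : `|omega s U| <= eps0 * (C1 / 2) * (enorm b * enorm p).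
  apply: (le_trans (omega_le _ _)).
  apply: (le_trans (ler_wpM2r (enorm_ge0 _) hs)).
  have := ler_wpM2l (mulr_ge0 eps0_ge0 b0) hU; lra.
have h3 : `|omega s u| <= eps0 * (eps0 * n%:R) * (enorm b * enorm p).
  apply: (le_trans (omega_le _ _)).
  apply: (le_trans (ler_pM (enorm_ge0 _) (enorm_ge0 _) hs hu)).
  by rewrite le_eqVlt -[in eqbRHS]sn; apply/orP; left; apply/eqP; ring.
have h4 : 0 <= eps0 * (eps0 * n%:R) * (enorm b * enorm p).
  by rewrite !mulr_ge0.
have -> : eps0 * C_Q * (enorm b * enorm p) = eps0 * C1 * (enorm b * enorm p) +
    2 * (eps0 * (eps0 * n%:R) * (enorm b * enorm p)) by rewrite /C_Q /C1; ring.
apply: (le_trans (ler_normD _ _)); rewrite mulr2n mulrDl mul1r.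
have := ler_normD (omega S u) (omega s U); lra.
Qed.

Let delta := eps0 * Num.sqrt (2 * n%:R * nu1 * row_max d).

(** Stable and unstable vectors have the same first components, so the unperturbed first component
    depends on p + q only. This gives |p + q| <= delta (|p| + |q|); inserting |q| <= |p + q| + |p|
    and absorbing yields 2 delta / (1 - delta), which is eps0 C_P. *)
Lemma dirichlet_perturbed p q : delta < 1 -> usubmx (VUx p + VSx q) = 0 ->
  enorm (p + q) <= 2 * delta / (1 - delta) * enorm p.
Proof.
move=> delta1; rewrite /VSx /VUx !big_split_V Vu_sum Vs_sum.
set u := \sum_j p j 0 *: wu j; set s := \sum_j q j 0 *: ws j.
rewrite !linearD/= !col_mxKu => E.
have profD : profile (p + q) = profile p + profile q.
  by rewrite /profile -big_split; apply: eq_bigr => j _; rewrite mxE mulrDr scalerDl.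
have {E}E : invmx (sqrtD d) *m profile (p + q) = - (usubmx u + usubmx s).
  apply/eqP; rewrite -addr_eq0 profD mulmxDr; apply/eqP; rewrite -[RHS]E.
  by rewrite addrACA.
have us : enorm (usubmx u + usubmx s) <=
    eps0 * Num.sqrt n%:R * (enorm p + enorm q).
  apply: (le_trans (enormD _ _)); rewrite mulrDr lerD//.
    by apply: (le_trans (enorm_usubmx _)); rewrite -mulrA; exact: enorm_W_le.
  by apply: (le_trans (enorm_usubmx _)); rewrite -mulrA; exact: enorm_W_le.
have h : enorm (p + q) <= delta * (enorm p + enorm q).
  apply: (le_trans (enorm_profile_ge _)).
  apply: (le_trans (ler_wpM2l (sqrtr_ge0 _) (enorm_invsqrtD_ge _))).
  rewrite E enormN mulrA.
  apply: (le_trans (ler_wpM2l (mulr_ge0 (sqrtr_ge0 _) (sqrtr_ge0 _)) us)).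
  rewrite mulrA ler_wpM2r ?addr_ge0 ?enorm_ge0// /delta.
  rewrite mulrCA -!sqrtrM ?mulr_ge0 ?(ltW nu1_gt0) ?(ltW row_max_gt0)//.
  by rewrite le_eqVlt; apply/orP; left; apply/eqP; congr (_ * Num.sqrt _); ring.
have delta0 : 0 <= delta by rewrite /delta mulr_ge0 ?sqrtr_ge0.
have q_le : enorm q <= enorm (p + q) + enorm p.
  by rewrite -{1}[q](addKr p) addrC; exact: enormB.
rewrite mulrAC ler_pdivlMr ?subr_gt0//.
have := ler_wpM2l delta0 q_le; lra.
Qed.

End perturbation.
End asymptotic_basis.

(** * Almost orthogonal and almost opposite vectors *)

Section angle.
Variable R : realType.

Lemma angle_eq0 m (p b : 'cV[R]_m) (r s : R) : 0 <= s ->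
  `|dot b p| <= r * (enorm b * enorm p) -> enorm (p + b) <= s * enorm p ->
  r ^+ 2 + s ^+ 2 < 1 -> p = 0.
Proof.
move=> s0 bp pb rs; apply: enorm_eq0.
have : enorm (p + b) ^+ 2 <= (s * enorm p) ^+ 2.
  by rewrite ler_pXn2r ?nnegrE ?mulr_ge0 ?enorm_ge0.
rewrite enorm_sqr dotDl !dotDr (dotC p b) -!enorm_sqr exprMn.
move: bp; rewrite ler_norml => /andP[bp _].
move: (enorm p) (enorm b) (enorm_ge0 p) (enorm_ge0 b) bp => P Q P0 Q0 bp h.
have : (1 - (r ^+ 2 + s ^+ 2)) * P ^+ 2 <= 0.
  (* Completing the square: |p + b|^2 >= P^2 - 2 r P Q + Q^2 >= (1 - r^2) P^2, against the upper
     bound s^2 P^2. *)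
  have := sqr_ge0 (Q - r * P); lra.
by rewrite pmulr_rle0 ?subr_gt0// real_exprn_even_le0//= ?num_real// => /eqP.
Qed.

End angle.

(** * Solutions in the eigenspace *)

Section solutions.
Variables (R : realType) (n : nat) (d : 'rV[R]_n) (M : R -> 'M[R]_n).
Hypothesis d_gt0 : forall j, 0 < d 0 j.
Hypothesis M_sym : forall x, (M x)^T = M x.

Lemma cvg_enorm0 T (F : set_system T) {FF : Filter F} m (f : T -> 'cV[R]_m) :
  f x @[x --> F] --> (0 : 'cV[R]_m) -> enorm (f x) @[x --> F] --> (0 : R).
Proof.
move=> f0; have -> : (fun x => enorm (f x)) = Num.sqrt \o (fun x => dot (f x) (f x)).
  by apply/funext => x /=; rewrite enorm_dot.
rewrite -[X in _ --> X]sqrtr0 -(dot0l (0 : 'cV[R]_m)).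
exact: (cvg_comp _ _ (cvg_dot f0 f0) (@sqrt_continuous _ _)).
Qed.

(** The pairing is constant and tends to 0 along F. It is used at -oo for the isotropy of E^u_- and
    at +oo for pairings with the [Vts]. *)
Lemma omega_eq0 (F : set_system R) {FF : ProperFilter F} U V (C : R) :
  is_solution d M U -> is_solution d M V ->
  U t @[t --> F] --> (0 : 'cV[R]_(n + n)) -> (\forall t \near F, enorm (V t) <= C) ->
  forall x, omega (U x) (V x) = 0.
Proof.
move=> Us Vs U0 VC x.
have oc : omega (U t) (V t) @[t --> F] --> omega (U x) (V x).
  under eq_fun do rewrite (omega_const d_gt0 M_sym Us Vs _ x).
  exact: cvg_cst.
suff o0 : omega (U t) (V t) @[t --> F] --> (0 : R) by exact: (cvg_unique _ oc o0).
apply: norm_cvg0.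
apply: (@squeeze_cvgr _ _ _ _ (cst 0) (fun t => enorm (U t) * C)).
- near=> t; rewrite normr_ge0/= (le_trans (omega_le _ _))//.
  by rewrite ler_wpM2l ?enorm_ge0//; near: t.
- exact: cvg_cst.
- rewrite -[X in _ --> X](mul0r C); apply: cvgM; last exact: cvg_cst.
  exact: cvg_enorm0.
Unshelve. all: by end_near. Qed.

Lemma Eu_minus_isotropic x u v : Eu_minus d M x u -> Eu_minus d M x v ->
  omega u v = 0.
Proof.
move=> [U [Us U0] <-] [V [Vs V0] <-].
apply: (omega_eq0 (C := 1) Us Vs U0).
exact: ((cvgr_le _) (cvg_enorm0 V0) _ ltr01).
Qed.

End solutions.

(** * From decaying solutions to L^2 eigenfunctions and back *)

Section eigenfunction.
Variables (R : realType) (n : nat) (d : 'rV[R]_n) (M : R -> 'M[R]_n).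
Hypothesis d_gt0 : forall j, 0 < d 0 j.
Hypothesis M_cont : continuous M.

(** The derivatives u' = D^-1 w and u'' = - D^-1 M u are bounded by multiples of |W|, hence square
    integrable. Continuity of M makes u'' continuous, so the classical derivatives are weak ones. *)
Lemma solution_Leigenspace (k C a : R) (W : R -> 'cV[R]_(n + n)) :
  (forall x (v : 'cV[R]_n), enorm (M x *m v) <= k * enorm v) ->
  0 < a -> is_solution d M W ->
  (forall x, dot (W x) (W x) <= C * expR (- a * `|x|)) ->
  Leigenspace d M 0 (fun x => usubmx (W x)).
Proof.
move=> Mk a0 Ws WC.
have k0 : 0 <= k \/ forall v : 'cV[R]_n, v = 0.
  have [k0|k0] := leP 0 k; [by left|right=> v].
  apply: enorm_eq0; apply/eqP; rewrite eq_le enorm_ge0 andbT.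
  by have := le_trans (enorm_ge0 _) (Mk 0 v); rewrite nmulr_rge0.
have {}Mk x (v : 'cV[R]_n) : enorm (M x *m v) <= `|k| * enorm v.
  by apply: (le_trans (Mk x v)); rewrite ler_wpM2r ?enorm_ge0// ler_norm.
have [kd kd0 Kd] := mulmx_enorm_bounded (invmx (diag_mx d)).
have WsP := (is_solutionP d M W).1 Ws.
have L2bound (f : R -> 'cV[R]_n) (b : R) : 0 <= b -> (forall i, continuous (fun x => f x i 0)) ->
    (forall x, enorm (f x) <= b * enorm (W x)) -> L2 f.
  move=> b0 fc fb i; apply: (@expRMabs_Lfun2 R _ (b ^+ 2 * C) a) => // x.
  rewrite -mulrA; apply: (@le_trans _ _ (b ^+ 2 * dot (W x) (W x))); last first.
    by rewrite ler_wpM2l ?sqr_ge0.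
  rewrite -enorm_sqr -exprMn -real_normK ?num_real//.
  rewrite ler_pXn2r ?nnegrE ?mulr_ge0 ?enorm_ge0//.
  by apply: (le_trans (entry_le_enorm _ _)).
have dcont (f df : R -> 'cV[R]_n) : (forall x : R, is_derive x 1 f (df x)) ->
    forall i, continuous (fun x => f x i 0).
  by move=> fd i x; exact: is_derive_continuous (is_derive_entry i 0 (fd x)).
have ucont := dcont _ _ (fun x => (WsP x).1).
pose u1 x := invmx (diag_mx d) *m dsubmx (W x).
pose u2 x := invmx (diag_mx d) *m (- M x *m usubmx (W x)).
have u1d (x : R) : is_derive x 1 u1 (u2 x).
  by apply: is_derive_mulmx; exact: (WsP x).2.
have u1cont := dcont _ _ u1d.
have u2cont i : continuous (fun x => u2 x i 0).
  have -> : (fun x => u2 x i 0) = (fun x => \sum_j invmx (diag_mx d) i j *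
      \sum_l - M x j l * usubmx (W x) l 0).
    apply/funext => x; rewrite /u2 mxE; apply: eq_bigr => j _; congr (_ * _).
    by rewrite mxE; apply: eq_bigr => l _; rewrite [X in X * _]mxE.
  move=> x; apply: cvg_bigsum => j; apply: cvgM; first exact: cvg_cst.
  apply: cvg_bigsum => l; apply: cvgM; last exact: ucont.
  by apply: cvgN; apply: cvg_mx_entry; exact: M_cont.
split.
  apply: (L2bound _ 0) => // [i|x].
    have -> : (fun x => (0 *: usubmx (W x)) i 0) = cst 0.
      by apply/funext => x; rewrite scale0r mxE.
    exact: cst_continuous.
  by rewrite scale0r enorm0 mul0r.
exists u1, u2; split.
- split; [|split].
  + by apply: (L2bound _ 1) => // x; rewrite mul1r enorm_usubmx.
  + apply: (L2bound _ kd) => // x; apply: (le_trans (Kd _)).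
    by rewrite ler_wpM2l// enorm_dsubmx.
  + apply: (L2bound _ (kd * `|k|)) => //; first by rewrite mulr_ge0.
    move=> x; apply: (le_trans (Kd _)); rewrite -mulrA ler_wpM2l//.
    rewrite mulNmx enormN (le_trans (Mk _ _))// ler_wpM2l//.
    exact: enorm_usubmx.
- move=> i; apply: is_derive_weak_derivative => // x.
  exact: is_derive_entry (WsP x).1.
- move=> i; apply: is_derive_weak_derivative => // x.
  exact: is_derive_entry (u1d x).
- apply: aeW => x; rewrite scale0r /u2 mulKVmx ?diag_mx_unit//.
  by rewrite mulNmx addNr.
Qed.

(** A point of disagreement would carry a whole ball of disagreement, which has positive measure. *)
Lemma ae_eq_continuous (f g : R -> 'cV[R]_n) : eq_ae f g ->
  (forall i, continuous (fun x => f x i 0)) -> (forall i, continuous (fun x => g x i 0)) ->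
  forall x, f x = g x.
Proof.
move=> [N [mN N0 fgN]] fc gc x; apply/matrixP => i j; rewrite ord1.
apply/eqP; rewrite -subr_eq0; apply/negP => /negP fgx.
have hc : {for x, continuous (fun y => f y i 0 - g y i 0)}.
  by apply: cvgB; [exact: fc|exact: gc].
have : \forall y \near x, f y i 0 - g y i 0 != 0.
  exact: (cvgr_neq0 _ hc fgx).
move=> /nbhs_ballP[r /= r0 rx].
have : (lebesgue_measure (ball x r) <= @lebesgue_measure R N)%E.
  apply: le_measure; rewrite ?inE//; first exact: measurable_ball.
  move=> y /rx/= fgy; apply: fgN => /= fg; move: fgy.
  by rewrite fg subrr eqxx.
rewrite N0 lebesgue_measure_ball ?(ltW r0)// lee_fin.
by rewrite leNgt mulrn_wgt0.
Qed.

End eigenfunction.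

(** * The fundamental matrix *)

Section fundamental_matrix.
Variables (R : realType) (n : nat) (hn : (1 < n)%N) (d : 'rV[R]_n).
Hypothesis d_gt0 : forall j, 0 < d 0 j.
Variables (M : R -> 'M[R]_n) (k : R).
Hypothesis M_sym : forall x, (M x)^T = M x.
Hypothesis sys_bound : forall x (v : 'cV[R]_(n + n)),
  enorm (sysmx d (M x) *m v) <= k * enorm v.
Variables (z : 'I_n -> 'cV[R]_n) (nu : 'I_n -> R).
Hypothesis z_orth : forall i j, (z i)^T *m z j = (i == j)%:R%:M.
Hypothesis nu_ord : forall i j : 'I_n, (i < j)%N -> nu j < nu i.
Hypothesis nu_gt0 : forall j, 0 < nu j.
Variables (L eps0 : R) (Ws Wu Vts Vtu : 'I_n -> R -> 'cV[R]_(n + n)).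
Hypothesis eps0_ge0 : 0 <= eps0.
Hypothesis VtsE : forall j x,
  Vts j x = expR (- nu j * x) *: (Vs d (nu j) (z j) + Ws j x).
Hypothesis VtuE : forall j x,
  Vtu j x = expR (nu j * x) *: (Vu d (nu j) (z j) + Wu j x).
Hypothesis Vts_sol : forall j, is_solution d M (Vts j).
Hypothesis Vtu_sol : forall j, is_solution d M (Vtu j).
Hypothesis Ws_le : forall j x, L <= x -> enorm (Ws j x) <= eps0.
Hypothesis Wu_le : forall j x, L <= x -> enorm (Wu j x) <= eps0.

Let r := eps0 * (Num.sqrt (2 * n%:R / (nu (ord_last hn) * row_min d)) +
  Num.sqrt (2 * n%:R * nu (ord_first hn) * row_max d) + 2 * eps0 * n%:R).
Hypothesis r_lt1 : r < 1.

Implicit Types (b c p q : 'cV[R]_n) (x : R).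

(** Turns coefficients of the solutions [Vts] or [Vtu] into coefficients of the frame V_j + W_j at
    x: [e] is [\- nu] in the stable and [nu] in the unstable case. *)
Definition exp_scale (e : 'I_n -> R) x c : 'cV[R]_n :=
  \col_j (expR (e j * x) * c j 0).

Lemma Vts_sumE c x : \sum_j c j 0 *: Vts j x =
  \sum_j exp_scale (\- nu) x c j 0 *: (Vs d (nu j) (z j) + Ws j x).
Proof. by apply: eq_bigr => j _; rewrite VtsE mxE scalerA mulrC. Qed.

Lemma Vtu_sumE c x : \sum_j c j 0 *: Vtu j x =
  \sum_j exp_scale nu x c j 0 *: (Vu d (nu j) (z j) + Wu j x).
Proof. by apply: eq_bigr => j _; rewrite VtuE mxE scalerA mulrC. Qed.

Lemma exp_scaleK e x c : exp_scale (\- e) x (exp_scale e x c) = c.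
Proof.
apply/matrixP => i j; rewrite ord1 !mxE mulrA -expRD.
by rewrite -mulrDl addNr mul0r expR0 mul1r.
Qed.

Lemma exp_scaleNK e x c : exp_scale e x (exp_scale (\- e) x c) = c.
Proof.
apply/matrixP => i j; rewrite ord1 !mxE mulrA -expRD.
by rewrite -mulrDl addrN mul0r expR0 mul1r.
Qed.

Lemma exp_scale_le e x (a : R) c :
  0 <= a -> (forall j, expR (e j * x) <= a) ->
  enorm (exp_scale e x c) <= a * enorm c.
Proof.
move=> a0 ea; apply: enorm_le; first by rewrite mulr_ge0 ?enorm_ge0.
rewrite exprMn enorm_sqr !dotE mulr_sumr; apply: ler_sum => j _.
rewrite mxE -!expr2 exprMn ler_wpM2r ?sqr_ge0//.
by rewrite ler_pXn2r ?nnegrE ?expR_ge0.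
Qed.

Lemma omega_Vts_Vtu b p x : L <= x ->
  `|omega (\sum_j b j 0 *: (Vs d (nu j) (z j) + Ws j x))
          (\sum_j p j 0 *: (Vu d (nu j) (z j) + Wu j x)) - dot b p|
  <= r * (enorm b * enorm p).
Proof.
by move=> Lx; apply: omega_perturbed => // j; [exact: Ws_le|exact: Wu_le].
Qed.

(** With equal coefficients on both sides the pairing is |p|^2 up to r |p|^2, hence definite for r <
    1. *)
Lemma omega_Vts_Vtu_eq0 p x : L <= x ->
  omega (\sum_j p j 0 *: (Vs d (nu j) (z j) + Ws j x))
        (\sum_j p j 0 *: (Vu d (nu j) (z j) + Wu j x)) = 0 -> p = 0.
Proof.
move=> Lx o0; have := omega_Vts_Vtu p p Lx.
rewrite o0 sub0r normrN ger0_norm ?dot_ge0// -expr2 enorm_sqr => h.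
apply: dot_eq0; apply/eqP; rewrite eq_le dot_ge0 andbT.
have : (1 - r) * dot p p <= 0 by lra.
by rewrite pmulr_rle0// subr_gt0.
Qed.

Lemma Vts_cvg0 j : Vts j x @[x --> +oo] --> (0 : 'cV[R]_(n + n)).
Proof.
apply: (@cvg0_enorm_le _ _ _ _ _ _
    (fun x => expR (- nu j * x) * (enorm (Vs d (nu j) (z j)) + eps0))).
  have : \forall x \near +oo, L <= x by apply: nbhs_pinfty_ge; rewrite num_real.
  apply: filterS => x Lx.
  rewrite VtsE enormZ ger0_norm ?expR_ge0// ler_wpM2l ?expR_ge0//.
  by rewrite (le_trans (enormD _ _))// lerD2l Ws_le.
rewrite -[X in _ --> X](mul0r (enorm (Vs d (nu j) (z j)) + eps0)).
apply: cvgM; last exact: cvg_cst.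
have -> : (fun t : R => expR (- nu j * t)) = (fun t => expR (- t)) \o (fun t => nu j * t).
  by apply/funext => t /=; rewrite mulNr.
apply: cvg_comp; last exact: cvgr_expR.
exact: gt0_cvgMry.
Qed.

Lemma Vts_sum_solution c : is_solution d M (fun x => \sum_j c j 0 *: Vts j x).
Proof. exact: solution_sum. Qed.

Lemma Vtu_sum_solution c : is_solution d M (fun x => \sum_j c j 0 *: Vtu j x).
Proof. exact: solution_sum. Qed.

Lemma omega_Vts_bounded c (U : R -> 'cV[R]_(n + n)) (C : R) : is_solution d M U ->
  (\forall t \near +oo, enorm (U t) <= C) ->
  forall x, omega (\sum_j c j 0 *: Vts j x) (U x) = 0.
Proof.
move=> Us UC x; rewrite omega_suml big1// => j _.
by rewrite omegaZl (omega_eq0 d_gt0 M_sym (Vts_sol j) Us (Vts_cvg0 j) UC) mulr0.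
Qed.

Lemma Vts_isotropic c c' x :
  omega (\sum_j c j 0 *: Vts j x) (\sum_j c' j 0 *: Vts j x) = 0.
Proof.
rewrite omega_sumr big1// => j _; rewrite omegaZr.
rewrite (@omega_Vts_bounded c (Vts j) 1) ?mulr0//.
exact: ((cvgr_le _) (cvg_enorm0 (Vts_cvg0 j)) _ ltr01).
Qed.

(** Growing solutions come first: [usubmx] of a coefficient vector is its unstable part, [dsubmx]
    its stable part. *)
Definition fundamental x : 'M[R]_(n + n) :=
  row_mx (\matrix_(i, j) Vtu j x i 0) (\matrix_(i, j) Vts j x i 0).

Lemma fundamentalE x (v : 'cV[R]_(n + n)) : fundamental x *m v =
  \sum_j usubmx v j 0 *: Vtu j x + \sum_j dsubmx v j 0 *: Vts j x.
Proof.
rewrite -{1}(vsubmxK v) mul_row_col.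
by congr (_ + _); apply/matrixP => i l; rewrite ord1 summxE mxE;
  apply: eq_bigr => j _; rewrite !mxE mulrC.
Qed.

Lemma fundamental_solution v : is_solution d M (fun x => fundamental x *m v).
Proof.
under eq_fun do rewrite fundamentalE.
exact: solutionD (Vtu_sum_solution _) (Vts_sum_solution _).
Qed.

(** Pairing with the [Vts] does not see the stable part, by isotropy, and detects the unstable part,
    by definiteness. *)
Lemma fundamental_usubmx_eq0 (v : 'cV[R]_(n + n)) :
  (forall c, omega (\sum_j c j 0 *: Vts j L) (fundamental L *m v) = 0) ->
  usubmx v = 0.
Proof.
move=> v0; set p := exp_scale nu L (usubmx v).
suff p0 : p = 0.
  rewrite -(exp_scaleK nu L (usubmx v)) -/p p0.
  by apply/matrixP => i j; rewrite !mxE mulr0.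
apply: (@omega_Vts_Vtu_eq0 _ L) => //.
(* Chosen so that the stable frame coefficients at L become p as well. *)
have := v0 (exp_scale nu L p).
rewrite fundamentalE omegaDr Vts_isotropic addr0.
by rewrite Vts_sumE exp_scaleK Vtu_sumE.
Qed.

Lemma fundamental_inj (v : 'cV[R]_(n + n)) : fundamental L *m v = 0 -> v = 0.
Proof.
move=> v0.
have u0 : usubmx v = 0.
  by apply: fundamental_usubmx_eq0 => c; rewrite v0 omega0r.
suff d0 : dsubmx v = 0 by rewrite -(vsubmxK v) u0 d0 col_mx0.
set q := exp_scale (\- nu) L (dsubmx v).
suff q0 : q = 0.
  rewrite -(exp_scaleNK nu L (dsubmx v)) -/q q0.
  by apply/matrixP => i j; rewrite !mxE mulr0.
apply: (@omega_Vts_Vtu_eq0 _ L) => //.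
move: v0; rewrite fundamentalE u0 big1 ?add0r; last first.
  by move=> j _; rewrite mxE scale0r.
by rewrite Vts_sumE -/q => ->; rewrite omegaC omega0r oppr0.
Qed.

Lemma solution_fundamental U : is_solution d M U ->
  exists v, forall x, U x = fundamental x *m v.
Proof.
move=> Us.
have Fu : fundamental L \in unitmx.
  rewrite -unitmx_tr -row_free_unit -kermx_eq0.
  apply/negP => /negP/rowV0Pn[v /sub_kermxP vF v0].
  have /eqP[] := v0; apply: trmx_inj; rewrite trmx0; apply: fundamental_inj.
  by rewrite -[fundamental L]trmxK -trmx_mul vF trmx0.
exists (invmx (fundamental L) *m U L); apply: (solution_unique (x0 := L) sys_bound Us).
  exact: fundamental_solution.
by rewrite mulKVmx.
Qed.

(** A bounded solution pairs to 0 with every decaying one, so it has no unstable part. Applied to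
    [Uphi], whose decay at +oo is thereby obtained from boundedness. *)
Lemma bounded_solution_Vts U (C : R) : is_solution d M U ->
  (\forall t \near +oo, enorm (U t) <= C) ->
  exists c, forall x, U x = \sum_j c j 0 *: Vts j x.
Proof.
move=> Us UC; have [v UE] := solution_fundamental Us.
have v0 : usubmx v = 0.
  by apply: fundamental_usubmx_eq0 => c; rewrite -UE (omega_Vts_bounded _ Us UC).
exists (dsubmx v) => x; rewrite UE fundamentalE v0 big1 ?add0r// => j _.
by rewrite mxE scale0r.
Qed.

Lemma Vts_sum_decay c : 0 <= L -> exists C : R, forall x, L <= x ->
  dot (\sum_j c j 0 *: Vts j x) (\sum_j c j 0 *: Vts j x) <=
  C * expR (- (2 * nu (ord_last hn)) * x).
Proof.
move=> L0; set a := nu (ord_last hn).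
pose C := \sum_j `|c j 0| * (enorm (Vs d (nu j) (z j)) + eps0).
exists (C ^+ 2) => x Lx.
have -> : C ^+ 2 * expR (- (2 * a) * x) = (C * expR (- a * x)) ^+ 2.
  by rewrite exprMn (expr2 (expR _)) -expRD; congr (_ * expR _); ring.
have C0 : 0 <= C.
  by rewrite sumr_ge0// => j _; rewrite mulr_ge0// addr_ge0// enorm_ge0.
rewrite -enorm_sqr ler_pXn2r ?nnegrE ?enorm_ge0 ?mulr_ge0 ?expR_ge0//.
apply: (le_trans (enorm_sum _)); rewrite mulr_suml; apply: ler_sum => j _.
rewrite enormZ VtsE enormZ -mulrA ler_wpM2l// mulrC.
rewrite ger0_norm ?expR_ge0// ler_pM ?enorm_ge0 ?expR_ge0//.
  by rewrite (le_trans (enormD _ _))// lerD2l Ws_le.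
(* The slowest rate nu_n dominates; this comparison of exponentials needs x >= 0, hence 0 <= L. *)
rewrite ler_expR !mulNr lerN2 ler_wpM2r ?(le_trans L0)//.
exact: nu_last_le.
Qed.

End fundamental_matrix.

(** * Decay estimates *)

Section decay_estimates.
Variable R : realType.

(** The terms with CM1 and CM2 are nonnegative, and the remaining ones exceed the expanded squares
    by 2e(CQ + CP) + 2 eb. *)
Lemma smallness (e CQ CP eb CM1 CM2 : R) :
  0 <= e -> 0 <= CQ -> 0 <= CP -> 0 <= eb -> 0 <= CM1 < 1 -> 0 <= CM2 < 1 ->
  2 * e * (CQ + CP) + e ^+ 2 * (CQ ^+ 2 + CP ^+ 2) + eb ^+ 2 + 2 * eb * (1 + e * CP) +
    (1 + e * CQ) ^+ 2 * (CM1 / (1 - CM1)) +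
    (1 + e * CP + eb) ^+ 2 * (CM2 / (1 - CM2)) < 1 ->
  (e * CQ) ^+ 2 + (e * CP + eb) ^+ 2 < 1.
Proof.
move=> e0 CQ0 CP0 eb0 /andP[M10 M11] /andP[M20 M21].
have t1 : 0 <= (1 + e * CQ) ^+ 2 * (CM1 / (1 - CM1)).
  by rewrite mulr_ge0 ?sqr_ge0// divr_ge0// subr_ge0 ltW.
have t2 : 0 <= (1 + e * CP + eb) ^+ 2 * (CM2 / (1 - CM2)).
  by rewrite mulr_ge0 ?sqr_ge0// divr_ge0// subr_ge0 ltW.
have := mulr_ge0 e0 CQ0; have := mulr_ge0 e0 CP0; lra.
Qed.

(** The two tails are given, with the smaller rate kept; Gronwall bridges the compact interval
    [x1, L]. *)
Lemma solution_exp_decay n (d : 'rV[R]_n) M (k x1 L a1 a2 C1 C2 : R) U :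
  (forall x (v : 'cV[R]_(n + n)), enorm (sysmx d (M x) *m v) <= k * enorm v) ->
  0 <= k -> x1 <= 0 -> 0 <= L -> 0 < a1 -> 0 < a2 -> is_solution d M U ->
  (forall x, x <= x1 -> dot (U x) (U x) <= C1 * expR (a1 * x)) ->
  (forall x, L <= x -> dot (U x) (U x) <= C2 * expR (- a2 * x)) ->
  exists a C : R, 0 < a /\ forall x, dot (U x) (U x) <= C * expR (- a * `|x|).
Proof.
move=> sysb k0 x10 L0 a10 a20 Us U1 U2.
pose a := Num.min a1 a2.
have a0 : 0 < a by rewrite lt_min a10.
(* The first exponential is the Gronwall growth across [x1, L]; the second compensates e^(-a |x|),
   as |x| <= L - x1 there. *)
pose C3 := dot (U x1) (U x1) * expR (2 * k * (L - x1)) * expR (a * (L - x1)).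
have C30 : 0 <= C3 by rewrite !mulr_ge0 ?dot_ge0 ?expR_ge0.
exists a, (`|C1| + `|C2| + C3); split=> // x.
have E0 := expR_ge0 (- a * `|x|).
have P1 := mulr_ge0 (normr_ge0 C1) E0.
have P2 := mulr_ge0 (normr_ge0 C2) E0.
have P3 := mulr_ge0 C30 E0.
rewrite !mulrDl.
have [xx1|/ltW x1x] := leP x x1.
  suff : dot (U x) (U x) <= `|C1| * expR (- a * `|x|) by lra.
  apply: (le_trans (U1 x xx1)).
  apply: (@le_trans _ _ (`|C1| * expR (a1 * x))).
    by rewrite ler_wpM2r ?expR_ge0// ler_norm.
  rewrite ler_wpM2l// ler_expR ler0_norm; last exact: le_trans x10.
  by rewrite mulrNN ler_wnM2r ?(le_trans xx1)// ge_min lexx.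
have [Lx|/ltW xL] := leP L x.
  suff : dot (U x) (U x) <= `|C2| * expR (- a * `|x|) by lra.
  apply: (le_trans (U2 x Lx)).
  apply: (@le_trans _ _ (`|C2| * expR (- a2 * x))).
    by rewrite ler_wpM2r ?expR_ge0// ler_norm.
  rewrite ler_wpM2l// ler_expR ger0_norm; last exact: le_trans Lx.
  by rewrite !mulNr lerN2 ler_wpM2r ?(le_trans L0)// ge_min lexx orbT.
suff : dot (U x) (U x) <= C3 * expR (- a * `|x|) by lra.
have [h _] := solution_growth sysb Us x1x.
have {}h : dot (U x) (U x) <= dot (U x1) (U x1) * expR (2 * k * (x - x1)).
  rewrite -(ler_pM2r (expR_gt0 (- 2 * k * x))) (le_trans h)// -[leRHS]mulrA -expRD.
  by rewrite le_eqVlt; apply/orP; left; apply/eqP; congr (_ * expR _); ring.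
apply: (le_trans h); rewrite /C3 -!mulrA ler_wpM2l ?dot_ge0// -!expRD ler_expR.
have : k * (x - x1) <= k * (L - x1) by rewrite ler_wpM2l// lerD2r.
have : a * `|x| <= a * (L - x1).
  rewrite ler_wpM2l ?(ltW a0)// ler_norml; apply/andP; split; lra.
lra.
Qed.

Lemma decay_cvgNy m (U : R -> 'cV[R]_m) (C a x1 : R) : 0 < a ->
  (forall x, x <= x1 -> dot (U x) (U x) <= C * expR (a * x)) ->
  U x @[x --> -oo] --> (0 : 'cV[R]_m).
Proof.
move=> a0 UC.
apply: (@cvg0_enorm_le _ _ _ _ _ _ (fun x => Num.sqrt (C * expR (a * x)))).
  have : \forall x \near -oo, x <= x1 by apply: nbhs_ninfty_le; rewrite num_real.
  by apply: filterS => x xx1; rewrite enorm_dot; apply: ler_wsqrtr; exact: UC.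
rewrite -[X in _ --> X]sqrtr0 -[X in Num.sqrt X](mulr0 C).
apply: (@cvg_comp _ _ _ (fun x => C * expR (a * x)) Num.sqrt _ _ _ _ (@sqrt_continuous _ _)).
apply: cvgM; first exact: cvg_cst.
apply/cvgNy_compNP.
have -> : (fun x => expR (a * - x)) = (fun t => expR (- t)) \o (fun t => a * t) :> (R -> R).
  by apply/funext => t /=; rewrite mulrN.
apply: cvg_comp; last exact: cvgr_expR.
exact: gt0_cvgMry.
Qed.

(** The flux tends to 0 at -oo and does not decrease. Plain convergence thus yields the hypothesis
    of [flux_ge0_decay], which supplies an exponential rate. *)
Lemma flux_ge0_of_cvg0 n (d : 'rV[R]_n) M (c x1 : R) U : 0 < c ->
  (forall w : 'cV[R]_n, c * dot w w <= dot w (invmx (diag_mx d) *m w)) ->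
  (forall x, x <= x1 -> forall u : 'cV[R]_n, c * dot u u <= - dot u (M x *m u)) ->
  is_solution d M U -> U x @[x --> -oo] --> (0 : 'cV[R]_(n + n)) ->
  forall x, x <= x1 -> 0 <= flux (U x).
Proof.
move=> c0 cD cM Us U0 x xx1; rewrite leNgt; apply/negP => fx.
have f0 : flux (U t) @[t --> -oo] --> (0 : R).
  rewrite -[X in _ --> X](dot0l (0 : 'cV[R]_n)).
  apply: cvg_dot.
    rewrite (_ : (0 : 'cV[R]_n) = usubmx (0 : 'cV[R]_(n + n))); last by rewrite linear0.
    exact: cvg_usubmx.
  rewrite (_ : (0 : 'cV[R]_n) = dsubmx (0 : 'cV[R]_(n + n))); last by rewrite linear0.
  exact: cvg_dsubmx.
have : \forall t \near -oo, flux (U x) < flux (U t).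
  by apply: (cvgr_gt 0).
have : \forall t \near -oo, t <= x by apply: nbhs_ninfty_le; rewrite num_real.
move=> h1 h2; have [t [tx]] := filter_ex (filterI h1 h2).
by rewrite ltNge (flux_nondecreasing c0 cD cM Us tx xx1).
Qed.

(** The explicit threshold comes from 1 + t <= e^t. *)
Lemma uniform_decay (C eta e : R) : 0 < C -> 0 < eta -> 0 < e ->
  forall x, x <= - (C / (eta * e)) -> C * expR (- eta * `|x|) <= e.
Proof.
move=> C0 eta0 e0 x xle.
have Q0 : 0 < C / (eta * e) by rewrite divr_gt0// mulr_gt0.
have x0 : x <= 0 by rewrite (le_trans xle)// oppr_le0 ltW.
rewrite ler0_norm// mulrNN.
have -> : eta * x = - (eta * - x) by ring.
rewrite expRN ler_pdivrMr ?expR_gt0//.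
have : 1 + eta * - x <= expR (eta * - x) by exact: expR_ge1Dx.
have : C / e <= eta * - x.
  have -> : C / e = eta * (C / (eta * e)) by field; rewrite !gt_eqF.
  by rewrite ler_pM2l// lerNr.
move=> h1 h2; rewrite mulrC -ler_pdivrMr//; lra.
Qed.

Lemma coercive_invD n (d : 'rV[R]_n) : (0 < n)%N -> (forall j, 0 < d 0 j) ->
  0 < row_max d /\
  forall w : 'cV[R]_n, (row_max d)^-1 * dot w w <= dot w (invmx (diag_mx d) *m w).
Proof.
move=> n0 d0.
have m0 : 0 < row_max d.
  by apply: lt_le_trans (d0 (Ordinal n0)) _; exact: le_bigmax.
split=> // w; rewrite invmx_diag// !dotE mulr_sumr; apply: ler_sum => j _.
have dj : (row_max d)^-1 <= (d 0 j)^-1 by rewrite lef_pV2 ?posrE// le_bigmax.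
rewrite mul_diag_mx !mxE; have := ler_wpM2r (sqr_ge0 (w j 0)) dj; lra.
Qed.

End decay_estimates.

(** * Proof of the theorem *)

Theorem theorem2 (R : realType) (n : nat) (hn : (1 < n)%N)
  (* the reaction-diffusion system and the stationary solution *)
  (d : 'rV[R]_n) (hd : forall j, 0 < d 0 j)
  (G : 'cV[R]_n -> R) (hG : C2 G)
  (phi : R -> 'cV[R]_n) (hphi : stationary_solution d G phi)
  (hphi_nonconst : ~ exists c, forall x, phi x = c)
  (phi_m phi_p : 'cV[R]_n)
  (hphi_m : phi x @[x --> -oo] --> phi_m)
  (hphi_p : phi x @[x --> +oo] --> phi_p)
  (M : R -> 'M[R]_n) (hM : forall x, M x = hessian G (phi x))
  (* (H1) *)
  (H1 : continuous M /\ forall x, (M x)^T = M x)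
  (* (H2) *)
  (M_m M_p : 'M[R]_n)
  (H2_lim : M x @[x --> -oo] --> M_m /\ M x @[x --> +oo] --> M_p)
  (H2_neg : neg_definite M_m /\ neg_definite M_p)
  (H2_dist : distinct_eigenvalues M_m /\ distinct_eigenvalues M_p)
  (* (H3) *)
  (C_M eta_M : R) (hC_M : 0 < C_M) (heta_M : 0 < eta_M)
  (H3_p : forall x, 0 <= x -> opnorm (M x - M_p) <= C_M * expR (- eta_M * `|x|))
  (H3_m : forall x, x <= 0 -> opnorm (M x - M_m) <= C_M * expR (- eta_M * `|x|))
  (* (H4) *)
  (H4 : Lsimple_eigenvalue d M 0)
  (H4_phi : Leigenfunction d M 0 (derive1 phi))
  (* the solutions U_1, ..., U_(n-1) *)
  (U : 'I_n.-1 -> R -> 'cV[R]_(n + n))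
  (hU_sol : forall k, is_solution d M (U k))
  (hU_span : forall x, Eu_minus d M x =
     [set v | exists (a : R) (c : 'I_n.-1 -> R),
        v = a *: Uphi d phi x + \sum_k c k *: U k x])
  (* the asymptotic basis at +oo *)
  (z : 'I_n -> 'cV[R]_n) (nu : 'I_n -> R)
  (hz_orth : forall i j, (z i)^T *m z j = (i == j)%:R%:M)
  (hz_eig : forall j,
     invmx (sqrtD d) *m M_p *m invmx (sqrtD d) *m z j = - nu j ^+ 2 *: z j)
  (hnu_ord : forall i j : 'I_n, (i < j)%N -> nu j < nu i)
  (hnu_pos : forall j, 0 < nu j)
  (K_p eta_p : R) (hK_p : 0 < K_p) (heta_p : 0 < eta_p)
  (hK_cu : forall (nu0 : R) (P : 'M[R]_(n + n)),
     eigenvalue (sysmx d M_p) nu0 ->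
     is_spectral_projection (sysmx d M_p - nu0%:M)
       (fun lam => 0 <= complex.Re lam) P ->
     forall x y : R, 0 <= x -> x <= y ->
       opnorm (expmx ((x - y) *: (sysmx d M_p - nu0%:M)) *m P) <= K_p)
  (hK_s : forall (nu0 : R) (P : 'M[R]_(n + n)),
     eigenvalue (sysmx d M_p) nu0 ->
     is_spectral_projection (sysmx d M_p - nu0%:M)
       (fun lam => complex.Re lam < 0) P ->
     forall x y : R, 0 <= y -> y <= x ->
       opnorm (expmx ((x - y) *: (sysmx d M_p - nu0%:M)) *m P)
         <= K_p * expR (- eta_p * (x - y)))
  (L_p : R) (hL_p : 0 < L_p)
  (lamT eps0 : R)
  (def_lamT : lamT = K_p * C_M / eta_M * expR (- eta_M * L_p))
  (def_eps0 : eps0 = lamT / (1 - lamT) *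
     \big[Num.max/0]_(j < n)
       Num.max (enorm (Vs d (nu j) (z j))) (enorm (Vu d (nu j) (z j))))
  (hlamT : lamT < 1)
  (Ws Wu Vts Vtu : 'I_n -> R -> 'cV[R]_(n + n))
  (def_Vts : forall j x,
     Vts j x = expR (- nu j * x) *: (Vs d (nu j) (z j) + Ws j x))
  (def_Vtu : forall j x,
     Vtu j x = expR (nu j * x) *: (Vu d (nu j) (z j) + Wu j x))
  (hVt_sol : forall j, is_solution d M (Vts j) /\ is_solution d M (Vtu j))
  (hW_lim : forall j,
     Ws j x @[x --> +oo] --> (0 : 'cV[R]_(n + n)) /\ Wu j x @[x --> +oo] --> (0 : 'cV[R]_(n + n)))
  (hWs_bound : forall j x, L_p <= x ->
     enorm (Ws j x) <= lamT / (1 - lamT) * enorm (Vs d (nu j) (z j)))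
  (hWu_bound : forall j x, L_p <= x ->
     enorm (Wu j x) <= lamT / (1 - lamT) * enorm (Vu d (nu j) (z j)))
  (* column k of Gam, B holds the coefficients of U_k *)
  (Gam B : 'M[R]_(n, n.-1))
  (hGamB : forall k x,
     U k x = \sum_j (Gam j k *: Vtu j x + B j k *: Vts j x))
  (* the constants *)
  (mu_star eps_b C_P C_Q C_M1 C_M2 : R)
  (def_mu_star : mu_star = min_spectrum (Gam^T *m Gam))
  (def_eps_b : eps_b = (Num.sqrt mu_star)^-1 *
     expR (- 2 * nu (ord_last hn) * L_p) * opnorm B)
  (def_C_P : C_P =
     2 * Num.sqrt (2 * n%:R * nu (ord_first hn) * row_max d) /
     (1 - eps0 * Num.sqrt (2 * n%:R * nu (ord_first hn) * row_max d)))
  (def_C_Q : C_Q =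
     Num.sqrt (2 * n%:R / (nu (ord_last hn) * row_min d)) +
     Num.sqrt (2 * n%:R * nu (ord_first hn) * row_max d) +
     2 * eps0 * n%:R)
  (def_C_M1 : C_M1 = eps0 * C_Q * (2 + eps0 * C_Q))
  (def_C_M2 : C_M2 = eps0 * C_P * (2 + eps0 * C_P) +
     2 * eps_b * (1 + eps0 * C_P) + eps_b ^+ 2)
  (* the smallness conditions on L_+ *)
  (heps0 : eps0 * Num.sqrt (2 * n%:R * nu (ord_first hn) * row_max d) < 1)
  (hC_M1 : C_M1 < 1)
  (hC_M2 : C_M2 < 1)
  (hsmall :
     2 * eps0 * (C_Q + C_P) + eps0 ^+ 2 * (C_Q ^+ 2 + C_P ^+ 2) +
     eps_b ^+ 2 + 2 * eps_b * (1 + eps0 * C_P) +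
     (1 + eps0 * C_Q) ^+ 2 * (C_M1 / (1 - C_M1)) +
     (1 + eps0 * C_P + eps_b) ^+ 2 * (C_M2 / (1 - C_M2)) < 1) :
  forall x : R, L_p <= x -> Eu_minus d M x `&` @Dirichlet R n = [set 0].
Proof.

(* Uniform constants: growth, coercivity, smallness *)
have [M_cont M_sym] := H1.
have n_gt0 : (0 < n)%N := ltnW hn.
have nE : (1 + n.-1)%N = n by rewrite add1n prednK.
have exp_le1 (x : R) : C_M * expR (- eta_M * `|x|) <= C_M.
  rewrite ler_piMr ?(ltW hC_M)// -expR0 ler_expR mulNr oppr_le0.
  by rewrite mulr_ge0 ?(ltW heta_M).
have [k k0 Mk] := sysmx_bounded d
  (fun x x0 => le_trans (H3_p x x0) (exp_le1 x))
  (fun x x0 => le_trans (H3_m x x0) (exp_le1 x)).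
have sysb x := (Mk x).2.
have [c1 [e1 [c10 e10 coer]]] := neg_definite_coercive n_gt0 H2_neg.1.
(* Left of x1, (H3) keeps M within e1 of its limit, so M inherits the coercivity of that limit. *)
pose x1 := - (C_M / (eta_M * e1)).
have x1_le0 : x1 <= 0 by rewrite oppr_le0 divr_ge0 ?mulr_ge0 ?ltW.
have M_near (x : R) : x <= x1 -> opnorm (M x - M_m) <= e1.
  move=> xx1; apply: (le_trans (H3_m x (le_trans xx1 x1_le0))).
  exact: uniform_decay.
have [dmax0 dcoer] := coercive_invD n_gt0 hd.
pose c := Num.min c1 (row_max d)^-1.
have c0 : 0 < c by rewrite lt_min c10 invr_gt0.
have cD (w : 'cV[R]_n) : c * dot w w <= dot w (invmx (diag_mx d) *m w).
  apply: le_trans (dcoer w); rewrite ler_wpM2r ?dot_ge0//.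
  by rewrite ge_min lexx orbT.
have cM (x : R) : x <= x1 -> forall u : 'cV[R]_n, c * dot u u <= - dot u (M x *m u).
  move=> xx1 u; apply: le_trans (coer _ (M_near _ xx1) u).
  by rewrite ler_wpM2r ?dot_ge0// ge_min lexx.
have lamT_gt0 : 0 < lamT.
  by rewrite def_lamT mulr_gt0 ?expR_gt0// divr_gt0// mulr_gt0.
have lam_ge0 : 0 <= lamT / (1 - lamT) by rewrite divr_ge0 ?subr_ge0 ?ltW.
have eps0_ge0 : 0 <= eps0 by rewrite def_eps0 mulr_ge0// bigmax_ge_id.
have Ws_le j (x : R) : L_p <= x -> enorm (Ws j x) <= eps0.
  move=> Lx; rewrite (le_trans (hWs_bound j x Lx))// def_eps0 ler_wpM2l//.
  by apply: le_trans (le_bigmax _ _ j); rewrite le_max lexx.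
have Wu_le j (x : R) : L_p <= x -> enorm (Wu j x) <= eps0.
  move=> Lx; rewrite (le_trans (hWu_bound j x Lx))// def_eps0 ler_wpM2l//.
  by apply: le_trans (le_bigmax _ _ j); rewrite le_max lexx orbT.
set delta := eps0 * Num.sqrt _ in heps0.
have C_Q0 : 0 <= C_Q by rewrite def_C_Q !addr_ge0 ?sqrtr_ge0// !mulr_ge0.
have C_P0 : 0 <= C_P.
  rewrite def_C_P divr_ge0 ?mulr_ge0 ?sqrtr_ge0// subr_ge0; exact: ltW.
have eps_b0 : 0 <= eps_b.
  by rewrite def_eps_b !mulr_ge0 ?invr_ge0 ?sqrtr_ge0 ?expR_ge0 ?opnorm_ge0.
have small : (eps0 * C_Q) ^+ 2 + (eps0 * C_P + eps_b) ^+ 2 < 1.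
  apply: smallness hsmall => //; rewrite ?hC_M1 ?hC_M2 andbT.
    rewrite def_C_M1; apply: mulr_ge0; first exact: mulr_ge0.
    by rewrite addr_ge0// mulr_ge0.
  rewrite def_C_M2 !addr_ge0 ?sqr_ge0//.
    by apply: mulr_ge0; [exact: mulr_ge0 | rewrite addr_ge0// mulr_ge0].
  by apply: mulr_ge0; [exact: mulr_ge0 | rewrite addr_ge0// mulr_ge0].
have kappaE : eps0 * C_P = 2 * delta / (1 - delta).
  by rewrite def_C_P /delta; set I := (1 - _)^-1; ring.
(* This makes the pairing nondegenerate, hence the given 2n solutions a basis. *)
have r_lt1 : eps0 * C_Q < 1.
  have : (eps0 * C_Q) ^+ 2 < 1 by have := sqr_ge0 (eps0 * C_P + eps_b); lra.
  by rewrite expr_lt1// mulr_ge0.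
rewrite def_C_Q in r_lt1.
have Vts_sol j := (hVt_sol j).1.
have Vtu_sol j := (hVt_sol j).2.

(* Coordinates of E^u_- in the asymptotic basis *)
pose F := fundamental Vts Vtu.
have Finj : forall v, F L_p *m v = 0 -> v = 0 :=
  fundamental_inj hd M_sym hz_orth hnu_ord hnu_pos eps0_ge0 def_Vts def_Vtu
    Vts_sol Ws_le Wu_le r_lt1.
have Fsol v : is_solution d M (fun x => F x *m v) := fundamental_solution Vts_sol Vtu_sol v.
have Phi_sol := Uphi_solution hd hG hphi hM.
have [Cphi Phi_bnd] := Uphi_bounded hd hG hphi hphi_p.
have [beta PhiE] := bounded_solution_Vts hd M_sym sysb hz_orth hnu_ord hnu_pos
  eps0_ge0 def_Vts def_Vtu Vts_sol Vtu_sol Ws_le Wu_le r_lt1 Phi_sol Phi_bnd.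
have USE (a : 'cV[R]_n.-1) (x : R) : \sum_k a k 0 *: U k x =
    \sum_j (Gam *m a) j 0 *: Vtu j x + \sum_j (B *m a) j 0 *: Vts j x.
  under eq_bigr do rewrite hGamB scaler_sumr.
  rewrite exchange_big -big_split/=; apply: eq_bigr => j _.
  rewrite !mxE !scaler_suml -big_split/=; apply: eq_bigr => i _.
  by rewrite scalerDr !scalerA !(mulrC (a i 0)).
(* The columns are the coefficient vectors of [Uphi], which is purely stable, and of the [U k];
   E^u_- at x lies in the image of [F x *m E]. *)
pose E : 'M[R]_(n + n, 1 + n.-1) := row_mx (col_mx 0 beta) (col_mx Gam B).
have FE (b : 'cV[R]_1) (a : 'cV[R]_n.-1) (x : R) : F x *m (E *m col_mx b a) =
    b 0 0 *: Uphi d phi x + \sum_k a k 0 *: U k x.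
  rewrite mul_row_col !mul_col_mx mul0mx add_col_mx add0r fundamentalE.
  rewrite col_mxKu col_mxKd USE PhiE addrCA; congr (_ + _).
  rewrite scaler_sumr -big_split; apply: eq_bigr => j _.
  rewrite mxE scalerDl mxE big_ord1 scalerA; congr (_ *: _ + _).
  by rewrite mulrC.
have EuE (x : R) v : Eu_minus d M x v -> exists e, v = F x *m (E *m e).
  rewrite hU_span => -[a [b ->]]; exists (col_mx a%:M (\col_k b k)).
  rewrite FE mxE eqxx mulr1n; congr (_ + _).
  by apply: eq_bigr => i _; rewrite mxE.

(* Injectivity of [Gam] *)
have Gam_inj (a : 'cV[R]_n.-1) : Gam *m a = 0 -> a = 0.
  (* The solution W with coefficients a decays at both ends, so by (H4) it is a
     multiple of Uphi and E^u_- has dimension less than n. *)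
  move=> Ga0; apply/eqP; apply/negP => /negP a_neq0.
  pose W x := \sum_k a k 0 *: U k x.
  have Wsol : is_solution d M W by exact: solution_sum.
  have WE x : W x = \sum_j (B *m a) j 0 *: Vts j x.
    by rewrite /W USE Ga0 big1 ?add0r// => j _; rewrite mxE scale0r.
  have WEu x : Eu_minus d M x (W x).
    by rewrite hU_span; exists 0, (fun i => a i 0); rewrite scale0r add0r.
  (* Membership at the single point 0 gives a solution V with V 0 = W 0 that tends to 0 at -oo; by
     uniqueness it is W. *)
  have W0 : W t @[t --> -oo] --> (0 : 'cV[R]_(n + n)).
    have [V [Vsol V0] V0E] := WEu 0.
    suff -> : W = V by [].
    by apply/funext => t; apply: (solution_unique (x0 := 0) sysb Wsol Vsol).
  have Wflux := flux_ge0_of_cvg0 c0 cD cM Wsol W0.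
  have [C1 WC1] := flux_ge0_decay sysb c0 cD cM Wsol Wflux.
  have [C2 WC2] := Vts_sum_decay hn hnu_ord eps0_ge0 def_Vts Ws_le (B *m a) (ltW hL_p).
  have WC2' x : L_p <= x -> dot (W x) (W x) <= C2 * expR (- (2 * nu (ord_last hn)) * x).
    by rewrite WE; exact: WC2.
  have [al [C [al0 WC]]] := solution_exp_decay sysb k0 x1_le0 (ltW hL_p)
    (mulr_gt0 (ltr0Sn _ 1) c0) (mulr_gt0 (ltr0Sn _ 1) (hnu_pos _)) Wsol WC1 WC2'.
  have LW := solution_Leigenspace hd M_cont (fun x => (Mk x).1) al0 Wsol WC.
  have [[u0 [_ _ u0dim]] _] := H4.
  have [phE ph_ne0] := H4_phi.
  have [cw cwE] := u0dim _ LW; have [cp cpE] := u0dim _ phE.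
  have FF := ae_filter_ringOfSetsType (@lebesgue_measure R).
  (* Both W and phi' are multiples of the same u0; the factor of phi' is nonzero because an
     eigenfunction is not 0 almost everywhere. *)
  have cp_ne0 : cp != 0.
    apply/eqP => cp0; apply: ph_ne0; apply: (@filterS _ _ FF) cpE => x ->.
    by rewrite cp0 scale0r.
  have uphi : eq_ae (fun x => usubmx (W x)) (fun x => (cw / cp) *: derive1 phi x).
    by apply: (@filterS2 _ _ FF) cwE cpE => x -> ->; rewrite scalerA divfK.
  have ud (x : R) := ((is_solutionP d M W).1 Wsol x).1.
  have phd (x : R) := is_deriveZ (cw / cp) (is_derive_phi' hphi x).
  have uE := ae_eq_continuous uphi
    (fun i x => is_derive_continuous (is_derive_entry i 0 (ud x)))
    (fun i x => is_derive_continuous (is_derive_entry i 0 (phd x))).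
  (* The first components agree at every x; differentiating them gives the second ones, because w =
     D u'. *)
  have WP x : W x = (cw / cp) *: Uphi d phi x.
    rewrite -[W x]vsubmxK /Uphi scale_col_mx -uE; congr col_mx.
    have E1 : invmx (diag_mx d) *m dsubmx (W x) = (cw / cp) *: derive1 (derive1 phi) x.
      by apply: is_derive_inj (ud x) (phd x); apply/funext => t; exact: uE.
    by rewrite scalemxAr -E1 mulKVmx ?diag_mx_unit.
  (* The relation between W and [Uphi] is a dependency among the columns of E, nontrivial because
     [a] is nonzero. *)
  pose e0 : 'cV[R]_(1 + n.-1) := col_mx (- (cw / cp))%:M a.
  have Ee0 : E *m e0 = 0.
    by apply: Finj; rewrite FE mxE eqxx mulr1n -/(W L_p) WP scaleNr addNr.
  have rE : (\rank E < n)%N.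
    rewrite -mxrank_tr -[X in (_ < X)%N]nE ltn_neqAle rank_leq_row andbT.
    apply/negP => free.
    have : e0^T *m E^T == 0 by rewrite -trmx_mul Ee0 trmx0.
    by rewrite mulmx_free_eq0// trmx_eq0 col_mx_eq0 (negbTE a_neq0) andbF.
  (* The vector v is orthogonal to the columns of E. Since its solution decays at -oo, v also lies
     in their span, which forces v . v = 0. *)
  have [v [Ev v0] vflux] := lower_rank_solution c0 cD cM Fsol rE.
  have [Cv vC] := flux_ge0_decay sysb c0 cD cM (Fsol v) vflux.
  have /EuE[e ve] : Eu_minus d M L_p (F L_p *m v).
    exists (fun x => F x *m v) => //; split; first exact: Fsol.
    by apply: decay_cvgNy vC; rewrite mulr_gt0.
  have vE : v = E *m e.
    apply/eqP; rewrite -subr_eq0; apply/eqP; apply: Finj.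
    by rewrite mulmxBr ve subrr.
  move/eqP: v0; apply; apply: dot_eq0.
  by rewrite {1}vE dot_mulmxl Ev dot0r.
have n1_gt0 : (0 < n.-1)%N by rewrite -ltnS prednK.
have [mu0 muP] := min_spectrum_gram n1_gt0 Gam_inj.

(* Elements of E^u_- satisfying the Dirichlet condition *)
move=> x Lx; apply/seteqP; split=> [v [Euv Dv]|_ ->]; last first.
  split; last by rewrite /Dirichlet/= linear0.
  rewrite hU_span; exists 0, (fun=> 0).
  by rewrite scale0r add0r big1// => i _; rewrite scale0r.
have Euv' := Euv; move: Euv'; rewrite hU_span => -[a0 [a vE]].
pose a' : 'cV[R]_n.-1 := \col_i a i.
have {}vE : v = a0 *: Uphi d phi x + \sum_k a' k 0 *: U k x.
  by rewrite vE; congr (_ + _); apply: eq_bigr => i _; rewrite mxE.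
(* Frame coefficients at x: p and s are the unstable and stable parts of the combination of the
   [U k], and b belongs to the multiple of [Uphi]. *)
pose p := exp_scale nu x (Gam *m a').
pose s := exp_scale (\- nu) x (B *m a').
pose b := exp_scale (\- nu) x (a0 *: beta).
have PhiVs : a0 *: Uphi d phi x = \sum_j (a0 *: beta) j 0 *: Vts j x.
  by rewrite PhiE scaler_sumr; apply: eq_bigr => j _; rewrite mxE scalerA.
(* Isotropy is applied to the [Uphi] part against the [U k] part; the stable coefficients of the
   latter drop out, leaving b against p. *)
have o0 : omega (\sum_j b j 0 *: (Vs d (nu j) (z j) + Ws j x))
    (\sum_j p j 0 *: (Vu d (nu j) (z j) + Wu j x)) = 0.
  rewrite -(Vts_sumE def_Vts) -(Vtu_sumE def_Vtu).
  have : omega (a0 *: Uphi d phi x) (\sum_k a' k 0 *: U k x) = 0.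
    apply: (Eu_minus_isotropic (x := x) hd M_sym); rewrite hU_span.
      by exists a0, (fun=> 0); rewrite big1 ?addr0// => i _; rewrite scale0r.
    by exists 0, (fun i => a' i 0); rewrite scale0r add0r.
  rewrite PhiVs USE omegaDr (Vts_isotropic hd M_sym hnu_pos def_Vts Vts_sol Ws_le) addr0.
  exact.
have bp : `|dot b p| <= eps0 * C_Q * (enorm b * enorm p).
  have := omega_Vts_Vtu hn hd hz_orth hnu_ord hnu_pos eps0_ge0 Ws_le Wu_le b p Lx.
  by rewrite o0 sub0r normrN -def_C_Q.
have vVU : v = \sum_j p j 0 *: (Vu d (nu j) (z j) + Wu j x) +
    \sum_j (s + b) j 0 *: (Vs d (nu j) (z j) + Ws j x).
  under [X in _ + X]eq_bigr do rewrite mxE scalerDl.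
  rewrite big_split/= vE USE PhiVs 2!(Vts_sumE def_Vts) (Vtu_sumE def_Vtu).
  by rewrite addrCA; congr (_ + _); rewrite addrC.
have dir : enorm (p + (s + b)) <= eps0 * C_P * enorm p.
  rewrite kappaE; apply: (dirichlet_perturbed (hn := hn) hd hz_orth hnu_ord hnu_pos
    eps0_ge0 (fun j => Ws_le j x Lx) (fun j => Wu_le j x Lx)) => //.
  by rewrite -vVU.
have s_le : enorm s <= eps_b * enorm p.
  (* One factor g comes from the stable scaling in s, the other from recovering a' from p, where the
     least eigenvalue contributes 1 / sqrt mu_star. Then g^2 <= e^(-2 nu_n L_p) because x >= L_p. *)
  pose g := expR (- nu (ord_last hn) * x).
  have x_ge0 : 0 <= x := le_trans (ltW hL_p) Lx.
  have scale_le v' : enorm (exp_scale (\- nu) x v') <= g * enorm v'.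
    apply: exp_scale_le; first exact: expR_ge0.
    move=> j; rewrite ler_expR ler_wpM2r//= lerN2; exact: nu_last_le.
  have Ga_le : enorm (Gam *m a') <= g * enorm p.
    by rewrite -{1}(exp_scaleK nu x (Gam *m a')) scale_le.
  have a_le : enorm a' <= (Num.sqrt mu_star)^-1 * (g * enorm p).
    rewrite ler_pdivlMl; last by rewrite sqrtr_gt0 def_mu_star.
    by apply: le_trans Ga_le; rewrite def_mu_star; exact: muP.
  have gg : g * g <= expR (- 2 * nu (ord_last hn) * L_p).
    rewrite -expRD ler_expR; have := ler_wpM2l (ltW (hnu_pos (ord_last hn))) Lx; lra.
  have Bn0 := opnorm_ge0 B; have g0 : 0 <= g := expR_ge0 _.
  apply: (le_trans (scale_le _)).
  apply: (le_trans (ler_wpM2l g0 (opnorm_bound _ _))).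
  apply: (le_trans (ler_wpM2l g0 (ler_wpM2l Bn0 a_le))).
  rewrite def_eps_b; set m := (Num.sqrt mu_star)^-1.
  have -> : g * (opnorm B * (m * (g * enorm p))) = g * g * (m * opnorm B * enorm p) by ring.
  have -> : m * expR (- 2 * nu (ord_last hn) * L_p) * opnorm B * enorm p =
    expR (- 2 * nu (ord_last hn) * L_p) * (m * opnorm B * enorm p) by ring.
  by rewrite ler_wpM2r// !mulr_ge0 ?enorm_ge0// invr_ge0 sqrtr_ge0.
have p0 : p = 0.
  apply: (angle_eq0 (s := eps0 * C_P + eps_b) _ bp _ small).
    by rewrite addr_ge0// mulr_ge0.
  (* Replacing s + b by b costs |s| <= eps_b |p|, which turns eps0 C_P into eps0 C_P + eps_b. *)
  have -> : p + b = (p + (s + b)) - s by rewrite [s + b]addrC addrA addrK.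
  by rewrite (le_trans (enormB _ _))// mulrDl lerD.
have a'0 : a' = 0.
  apply: Gam_inj; rewrite -(exp_scaleK nu x (Gam *m a')) -/p p0.
  by apply/matrixP => i j; rewrite !mxE mulr0.
have s0 : s = 0.
  by rewrite /s a'0 mulmx0; apply/matrixP => i j; rewrite !mxE mulr0.
(* With p = s = 0 the Dirichlet estimate reads |b| <= 0. *)
have b0 : b = 0.
  apply: enorm_eq0; apply/eqP; rewrite eq_le enorm_ge0 andbT.
  by move: dir; rewrite p0 s0 !add0r enorm0 mulr0.
rewrite vVU p0 s0 b0 addr0 !big1 ?addr0// => j _; by rewrite mxE scale0r.
Qed.
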